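(* If $H$ is a unimodular cocompact (closed) subgroup of a locally compact group $G$, then the pair $(G,H)$ is a Hecke pair.
   Context: A pair $(G,H)$ consists of a locally compact group $G$ and a closed subgroup $H$; $H$ is cocompact if $H\backslash G$ (the space of right cosets) is compact. Let $\mu,\eta$ be right Haar measures on $G,H$. For $H$ unimodular and cocompact, $G$ is unimodular, and $H\backslash G$ carries a right $G$-invariant Radon measure $\nu$ satisfying Weil's formula $\int_G f\,d\mu=\int_{H\backslash G}\int_H f(hy)\,d\eta(h)\,d\nu(Hy)$ for all $f\in C_c(G)$. The Hecke algebra is $\mathcal{H}(G,H)=\{f\in C_c(H\backslash G): f(Hxh)=f(Hx)\ \forall x\in G,h\in H\}$, with product $(f\ast g)(Hx)=\int_{H\backslash G}f(Hxy^{-1}H)g(Hy)\,d\nu(Hy)$ (where $f(HxH)=f(Hx)$). For $\xi\in L^2(H\backslash G,\nu)$, $f\ast\xi$ is defined by the same formula. A pair $(G,H)$ with $H$ unimodular and with such a measure $\nu$ is called a Hecke pair if: (a) $\lambda:\mathcal{H}(G,H)\to B(L^2(H\backslash G,\nu))$, $\lambda(f)(\xi)=f\ast\xi$, is a well defined homomorphism (in particular each $\lambda(f)$ is a bounded operator); and (b) for every $x\in G$ there is $f\in\mathcal{H}(G,H)$ with $f(Hx)\neq0$. (When $H$ is open in $G$, the pair is called a discrete Hecke pair if every double coset of $H$ in $G$ is a union of finitely many left cosets of $H$.) *)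

(* Defs.v *)
From HB Require Import structures.
From mathcomp Require Import all_boot all_order all_algebra.
From mathcomp Require Import all_classical all_reals all_analysis.
From mathcomp.real_closed Require Export complex.

Set Implicit Arguments.
Unset Strict Implicit.
Unset Printing Implicit Defensive.

Import Order.TTheory GRing.Theory Num.Theory.
Import numFieldNormedType.Exports.

Local Open Scope classical_set_scope.
Local Open Scope ring_scope.
Local Open Scope complex_scope.
Local Open Scope quotient_scope.

HB.mixin Record isTopologicalGroup G of Group G & Topological G := {
  mulg_continuous : continuous (fun x : G * G => (x.1 * x.2)%g);
  invg_continuous : continuous (fun x : G => (x^-1)%g)
}.

(* Pointed is required by g_sigma_algebraType; the distinguished point plays
   no role. *)
#[short(type="topologicalGroupType")]
HB.structure Definition TopologicalGroup :=
  {G of Group G & Topological G & Pointed G & isTopologicalGroup G}.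

Record subgroup (G : groupType) := Subgroup {
  subgroup_set :> set G;
  subgroup_closed : group_closed (fun x : G => x \in subgroup_set)
}.

Section subgroup_type.
Variables (G : topologicalGroupType) (H : subgroup G).

(* A fresh name, since set_type does not carry the subType instances. *)
Definition subgroup_type : Type := set_type H.

HB.instance Definition _ :=
  SubChoice.copy subgroup_type {x : G | x \in (H : set G)}.
HB.instance Definition _ := Topological.copy subgroup_type (set_type H).
HB.instance Definition _ :=
  SubChoice_isSubGroup.Build G _ subgroup_type (subgroup_closed H).
HB.instance Definition _ := isPointed.Build subgroup_type 1%g.

Let val_continuous : continuous (val : subgroup_type -> G).
Proof. exact: initial_continuous. Qed.

Let mulH_continuous :
  continuous (fun x : subgroup_type * subgroup_type => (x.1 * x.2)%g).
Proof.
apply: continuous_comp_initial => x.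
have -> : (set_val \o fun x : subgroup_type * subgroup_type => (x.1 * x.2)%g) =
    (fun z : G * G => (z.1 * z.2)%g) \o
    (fun x : subgroup_type * subgroup_type => (val x.1, val x.2)).
  by apply/funext => z; rewrite set_valE; exact: (@valM _ _ subgroup_type).
apply: continuous_comp; last exact: mulg_continuous.
apply: cvg_pair => /=.
- apply: continuous_comp; [exact: cvg_fst|exact: val_continuous].
- apply: continuous_comp; [exact: cvg_snd|exact: val_continuous].
Qed.

Let invH_continuous : continuous (fun x : subgroup_type => (x^-1)%g).
Proof.
apply: continuous_comp_initial => x.
have -> : (set_val \o fun x : subgroup_type => (x^-1)%g) =
    (fun z : G => (z^-1)%g) \o (val : subgroup_type -> G).
  by apply/funext => z; rewrite set_valE.
apply: continuous_comp; [exact: val_continuous|exact: invg_continuous].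
Qed.

HB.instance Definition _ :=
  isTopologicalGroup.Build (subgroup_type) mulH_continuous invH_continuous.

End subgroup_type.

(* The space H\G of right cosets Hx, with the quotient topology. *)
Section coset_space.
Variables (G : topologicalGroupType) (H : subgroup G).

Definition coset_rel (x y : G) : bool := (x * y^-1)%g \in (H : set G).

Let coset_rel_refl : reflexive coset_rel.
Proof.
by move=> x; rewrite /coset_rel mulgV; case: (subgroup_closed H).
Qed.

Let coset_rel_sym : symmetric coset_rel.
Proof.
have inv x y : coset_rel x y -> coset_rel y x.
  move=> /(group_closedV (subgroup_closed H)).
  by rewrite /in_mem /= invgM invgK.
by move=> x y; apply/idP/idP; exact: inv.
Qed.

Let coset_rel_trans : transitive coset_rel.
Proof.
move=> y x z xy yz.
have := group_closedM (subgroup_closed H) xy yz.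
by rewrite mulgA mulgVK.
Qed.

Canonical coset_equiv :=
  EquivRel coset_rel coset_rel_refl coset_rel_sym coset_rel_trans.

Definition coset_space : Type := quotient_topology {eq_quot coset_rel}.

HB.instance Definition _ := Topological.on coset_space.
HB.instance Definition _ := Pointed.on coset_space.
HB.instance Definition _ := Quotient.on coset_space.

Definition rcoset (x : G) : coset_space := \pi_coset_space x.

Definition coset_act (u : coset_space) (g : G) : coset_space :=
  rcoset (repr u * g)%g.

End coset_space.

(* Re and Im with values in R, rather than Num.Re and Num.Im. *)
Local Notation Re := (@complex.Re _).
Local Notation Im := (@complex.Im _).

Notation borel T := (g_sigma_algebraType (@open T)).

Section complex_functions.
Variables (R : realType) (T : ptopologicalType).
Implicit Types (m : {measure set (borel T) -> \bar R}) (f g : T -> R[i]).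

(* C_c(T); R[i]^o is R[i] with the topology of its norm. *)
Definition compactly_supported f : Prop :=
  continuous (f : T -> R[i]^o) /\ compact (closure [set x | f x != 0]).

Definition cintegrable m f : Prop :=
  m.-integrable setT (fun x => (Re (f x))%:E) /\
  m.-integrable setT (fun x => (Im (f x))%:E).

Definition cintegral m f : R[i] :=
  (\int[m]_x Re (f x)) +i* (\int[m]_x Im (f x)).

Definition L2norm m f : \bar R := Lnorm m 2%:E (fun x => (Re `|f x|)%:E).

(* Square-integrable functions. The space L^2 is their quotient by equality
   almost everywhere; operators on L^2 are given by maps of representatives. *)
Definition L2 m f : Prop :=
  [/\ measurable_fun setT (fun x : borel T => Re (f x)),
      measurable_fun setT (fun x : borel T => Im (f x))
    & (L2norm m f < +oo)%E].

Definition aeeq m f g : Prop := {ae m, forall x, f x = g x}.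

Definition L2_bounded_operator m (A : (T -> R[i]) -> (T -> R[i])) : Prop :=
  [/\ forall f, L2 m f -> L2 m (A f),
      forall f g, L2 m f -> L2 m g -> aeeq m f g -> aeeq m (A f) (A g),
      forall (a : R[i]) f g, L2 m f -> L2 m g ->
        aeeq m (A (fun x => a * f x + g x)) (fun x => a * A f x + A g x)
    & exists M : R, forall f, L2 m f -> (L2norm m (A f) <= M%:E * L2norm m f)%E].

Definition radon m : Prop :=
  [/\ forall K : set T, compact K -> (m K < +oo)%E,
      forall A : set (borel T), measurable A ->
        m A = ereal_inf [set m U | U in [set U : set T | open U /\ A `<=` U]]
    & forall U : set T, open U ->
        m U = ereal_sup [set m K | K in [set K : set T | compact K /\ K `<=` U]]].

End complex_functions.

Section haar.
Variables (R : realType) (G : topologicalGroupType).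
Implicit Types m : {measure set (borel G) -> \bar R}.

Definition left_invariant m : Prop :=
  forall (g : G) (A : set (borel G)), measurable A ->
    m [set (g * x)%g | x in (A : set G)] = m A.

Definition right_invariant m : Prop :=
  forall (g : G) (A : set (borel G)), measurable A ->
    m [set (x * g)%g | x in (A : set G)] = m A.

Definition right_haar m : Prop :=
  [/\ radon m, right_invariant m & m setT <> 0%E].

End haar.

Definition unimodular (R : realType) (G : topologicalGroupType) : Prop :=
  forall m : {measure set (borel G) -> \bar R},
    right_haar m -> left_invariant m.

Section hecke.
Variables (R : realType) (G : topologicalGroupType) (H : subgroup G).
Local Notation X := (coset_space H).
Implicit Types (mu : {measure set (borel G) -> \bar R})
  (eta : {measure set (borel (subgroup_type H)) -> \bar R})
  (nu : {measure set (borel X) -> \bar R}) (f g xi : X -> R[i]).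

(* The inner integral depends only on the coset u as eta is right invariant. *)
Definition weil_formula mu eta nu : Prop :=
  forall F : G -> R[i], compactly_supported F ->
    cintegral mu F =
    cintegral nu (fun u => cintegral eta (fun h => F (val h * repr u)%g)).

Definition coset_invariant nu : Prop :=
  forall (g : G) (A : set (borel X)), measurable A ->
    nu [set coset_act u g | u in (A : set X)] = nu A.

Definition weil_measure mu eta nu : Prop :=
  [/\ radon nu, coset_invariant nu & weil_formula mu eta nu].

Definition hecke_algebra f : Prop :=
  compactly_supported f /\
  forall (x : G) (h : subgroup_type H),
    f (rcoset H (x * val h)%g) = f (rcoset H x).

(* f (H x y^-1 H) xi (Hy) with Hx = u and Hy = v; for f in the Hecke algebra it
   does not depend on the representatives x of u and y of v. *)
Definition conv_kernel f xi (u v : X) : R[i] :=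
  f (rcoset H (repr u * (repr v)^-1)%g) * xi v.

Definition conv nu f xi : X -> R[i] :=
  fun u => cintegral nu (conv_kernel f xi u).

Definition regular_representation nu : Prop :=
  [/\ forall f, hecke_algebra f ->
        (forall xi, L2 nu xi ->
           {ae nu, forall u, cintegrable nu (conv_kernel f xi u)}) /\
        L2_bounded_operator nu (conv nu f),
      forall (a : R[i]) f g xi, hecke_algebra f -> hecke_algebra g ->
        L2 nu xi ->
        aeeq nu (conv nu (fun u => a * f u + g u) xi)
                (fun u => a * conv nu f xi u + conv nu g xi u)
    & forall f g, hecke_algebra f -> hecke_algebra g ->
        hecke_algebra (conv nu f g) /\
        forall xi, L2 nu xi ->
          aeeq nu (conv nu (conv nu f g) xi) (conv nu f (conv nu g xi))].

(* nu is uniquely determined by mu and eta, hence quantifying universally over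
   nu in the last clause is the same as fixing one. *)
Definition hecke_pair mu eta : Prop :=
  [/\ unimodular R (subgroup_type H),
      exists nu, weil_measure mu eta nu
    & forall nu, weil_measure mu eta nu ->
        regular_representation nu /\
        forall x : G, exists2 f, hecke_algebra f & f (rcoset H x) != 0].

End hecke.

(* Main.v *)
Require Import Defs.
From HB Require Import structures.
From mathcomp Require Import all_boot all_order all_algebra.
From mathcomp Require Import all_classical all_reals all_analysis.
From mathcomp Require Import finmap measurable_realfun ring lra.

Set Implicit Arguments.
Unset Strict Implicit.
Unset Printing Implicit Defensive.

Import Order.TTheory GRing.Theory Num.Theory.
Import numFieldNormedType.Exports.
Local Open Scope classical_set_scope.
Local Open Scope ring_scope.

(** Write X for H\G and pi : G -> X for the projection.  Two things have to be
    shown: X carries an invariant Radon measure nu satisfying Weil's formula,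
    and every such nu makes convolution a representation by bounded operators.
    Compactness of X does most of the work in both.

    For the second part, nu is finite and an element f of the Hecke algebra is
    a continuous function on X.  Being invariant under H on both sides, it
    defines a continuous, hence bounded, kernel f(H x y^-1 H) on X x X, and
    convolution by f is the integral operator with this kernel.  Boundedness on
    L^2 follows from the inclusion of L^2 in L^1 (Hoelder), and
    multiplicativity from Fubini's theorem together with the invariance of nu
    ([conv_assoc]).  The constant function 1 is in the Hecke algebra, so no
    point of X is annihilated by the whole algebra.

    The measure nu is explicit.  As X is compact there is phi >= 0, continuous with compact support on G, whose
    integral over every coset is 1 ([exists_cutoff]); nu is the image under pi
    of the measure phi.mu.  It inherits the regularity of mu
    ([density_radon]).  Writing f^H(x) for the integral of f(h x) over h in H
    ([fiber]), the key identity is, for f and g of compact support and c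
    continuous and left invariant under H,
        int f c g^H dmu = int f^H c g dmu        ([fiber_swap1]).
    With f := phi and c := 1 this is Weil's formula.  With g a right translate
    of phi and c lifted from X, it says that nu and its translate have the same
    integrals of continuous functions, so they coincide ([radon_eq]).

    The key identity is an exchange of integrals followed by x |-> h^-1 x in G
    and h |-> h^-1 in H.  The second substitution preserves eta because eta is
    both left and right invariant ([haar_invg]).  The first one multiplies mu
    by a continuous character D of G ([haar_modular_function]), so it is
    harmless once D = 1.  To see that D = 1, use the variant of the identity
    in which c is 1/D, so that the factors D cancel ([fiber_swap]).  For phi and
    its translate by g^-1, it shows that the integral of phi/D, a positive
    number, is multiplied by D(g)^-1 without changing ([haar_unimodular]).

    Haar measures need not be sigma-finite, and the Borel sets of a product
    need not be generated by rectangles.  So Fubini's theorem is proved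
    directly for continuous kernels on products of compact sets, by uniform
    approximation ([fubini_weighted]). *)

(** * Borel sets and integrals of continuous functions *)

Section borel_integration.
Variables (R : realType) (T : ptopologicalType).
Implicit Types (m : {measure set (borel T) -> \bar R}) (f g : T -> R).

Lemma open_borel (U : set T) : open U -> measurable (U : set (borel T)).
Proof. by move=> oU; apply: sub_sigma_algebra. Qed.

Lemma closed_borel (C : set T) : closed C -> measurable (C : set (borel T)).
Proof.
move=> cC; rewrite -(setCK C); apply: measurableC; apply: open_borel.
exact: closed_openC.
Qed.

Lemma compact_borel (K : set T) :
  hausdorff_space T -> compact K -> measurable (K : set (borel T)).
Proof. by move=> hT cK; apply: closed_borel; exact: compact_closed. Qed.

Lemma measure_mono m (A B : set (borel T)) :
  measurable A -> measurable B -> A `<=` B -> (m A <= m B)%E.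
Proof. by move=> mA mB; apply: le_measure; exact/mem_set. Qed.

Lemma continuous_borel f :
  continuous f -> measurable_fun setT (f : borel T -> R).
Proof.
move=> /continuousP cf; apply: (measurability _ (RGenOpens.measurableE R)).
move=> _ [_ [a [b ->] <-]]; rewrite setTI; apply: open_borel; apply: cf.
exact: interval_open.
Qed.

Lemma continuous_integrable m f (K : set T) : hausdorff_space T ->
  compact K -> (m K < +oo)%E -> continuous f -> m.-integrable K (EFin \o f).
Proof.
move=> hT cK mK cf; apply: measurable_bounded_integrable => //.
- exact: compact_borel.
- by apply: measurable_funTS; apply: continuous_borel.
- have [M [_ MP]] : bounded_set (f @` K).
    apply: compact_bounded; apply: continuous_compact => //.
    exact: continuous_subspaceT.
  exists M; split; first by rewrite num_real.
  by move=> y My x Kx; apply: (MP y My); exists x.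
Qed.

Lemma integrable_measurable m (S : set (borel T)) f :
  m.-integrable S (EFin \o f) -> measurable_fun S (f : borel T -> R).
Proof. by move=> /measurable_int/measurable_EFinP. Qed.

Lemma dominated_Rintegral m (S : set (borel T)) (u v : T -> R) (c : R) :
  measurable S -> measurable_fun S (u : borel T -> R) ->
  m.-integrable S (EFin \o v) ->
  (forall x, S x -> `|u x| <= c * `|v x|) ->
  m.-integrable S (EFin \o u) /\
  `|\int[m]_(x in S) u x| <= c * \int[m]_(x in S) `|v x|.
Proof.
move=> mS mu iv uv.
have iv' : m.-integrable S (EFin \o (fun x => c * `|v x|)).
  rewrite (_ : _ \o _ = (fun x => c%:E * `|(EFin \o v) x|)%E).
    by apply: integrableZl => //; exact: integrable_abse.
  by apply/funext => x /=; rewrite EFinM.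
have iu : m.-integrable S (EFin \o u).
  apply: (le_integrable mS _ _ iv'); first exact/measurable_EFinP.
  move=> x Sx /=; rewrite lee_fin (le_trans (uv x Sx))//; exact: ler_norm.
split=> //; apply: (le_trans (le_normr_Rintegral _ _)) => //.
rewrite -RintegralZl//; last exact: (integrable_norm iv).
apply: le_Rintegral => //; exact: (integrable_norm iu).
Qed.

End borel_integration.

Lemma continuous_measurable (T T' : ptopologicalType) (theta : T -> T') :
  continuous theta -> measurable_fun setT (theta : borel T -> borel T').
Proof.
move=> /continuousP ct.
apply: (@measurability _ _ (borel T) (borel T') _ _ (@open T')) => //.
by move=> _ [U oU <-]; rewrite setTI; apply: open_borel; exact: ct.
Qed.

(** * Parametric integrals and Fubini's theorem *)

Lemma continuous_slicer (T Y Z : topologicalType) (F : T * Y -> Z) (t : T) :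
  continuous F -> continuous (fun y => F (t, y)).
Proof.
move=> cF y; apply: (@continuous_comp _ _ _ (fun y => (t, y)) F); last exact: cF.
by apply: cvg_pair; [exact: cvg_cst|exact: cvg_id].
Qed.

Lemma continuous_slicel (T Y Z : topologicalType) (F : T * Y -> Z) (y : Y) :
  continuous F -> continuous (fun t => F (t, y)).
Proof.
move=> cF t; apply: (@continuous_comp _ _ _ (fun t => (t, y)) F); last exact: cF.
by apply: cvg_pair; [exact: cvg_id|exact: cvg_cst].
Qed.

Section tube.
Variables (R : realType) (T Y : topologicalType).

(** The tube lemma, in the form that gives uniform continuity in the parameter
    over a compact set. *)
Lemma near_uniform (F : T * Y -> R) (B : set Y) (t0 : T) (e : R) :
  continuous F -> compact B -> 0 < e ->
  \forall t \near t0, forall y, B y -> `|F (t, y) - F (t0, y)| < e.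
Proof.
move=> cF /compact_near_coveringP cB e0.
apply: (cB T (nbhs t0) (fun t y => `|F (t, y) - F (t0, y)| < e)) => y0 _.
have e2 : 0 < e / 2 by rewrite divr_gt0.
have /cvgrPdist_lt/(_ _ e2) [[/= U V [nU nV] UV]] := cF (t0, y0).
exists (V, U) => //= -[y t] /= [Vy Ut].
have := UV (t, y) (conj Ut Vy).
have := UV (t0, y) (conj (nbhs_singleton nU) Vy).
rewrite /= => h1 h2.
rewrite (_ : _ - _ = (F (t0, y0) - F (t0, y)) - (F (t0, y0) - F (t, y))).
  by rewrite (le_lt_trans (ler_normB _ _))// (splitr e) ltrD.
by ring.
Qed.

End tube.

Section weighted.
Variables (R : realType) (T Y : ptopologicalType).
Variables (n : {measure set (borel Y) -> \bar R}).
Variables (F : T * Y -> R) (B : set Y) (zeta : Y -> R).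
Hypotheses (cF : continuous F) (hY : hausdorff_space Y) (cB : compact B).
Hypothesis (iz : n.-integrable B (EFin \o zeta)).

Let cFr t : continuous (fun y => F (t, y)).
Proof. exact: continuous_slicer. Qed.

Let mB : measurable (B : set (borel Y)). Proof. exact: compact_borel. Qed.

Lemma kernel_measurable t :
  measurable_fun (B : set (borel Y)) (fun y : borel Y => F (t, y) * zeta y).
Proof.
apply: measurable_funM; first by apply: measurable_funTS; apply: continuous_borel.
exact: (integrable_measurable iz).
Qed.

Lemma kernel_integrable t : n.-integrable B (EFin \o (fun y => F (t, y) * zeta y)).
Proof.
have [M [_ MP]] : bounded_set ((fun y => F (t, y)) @` B).
  apply: compact_bounded; apply: continuous_compact => //.
  exact: continuous_subspaceT.
have Fb y : B y -> `|F (t, y) * zeta y| <= (`|M| + 1) * `|zeta y|.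
  move=> By; rewrite normrM ler_wpM2r//.
  apply: (MP (`|M| + 1)); last by exists y.
  by rewrite (le_lt_trans (ler_norm M))// ltrDl.
by have [] := dominated_Rintegral mB (kernel_measurable t) iz Fb.
Qed.

(** A kernel uniformly close to a slice has an integral close to that of the
    slice, in the weighted L^1 sense; both continuity in the parameter and
    Fubini's theorem rest on this estimate. *)
Lemma kernel_integral_near t t0 e :
  (forall y, B y -> `|F (t, y) - F (t0, y)| <= e) ->
  `|\int[n]_(y in B) (F (t, y) * zeta y) - \int[n]_(y in B) (F (t0, y) * zeta y)|
    <= e * \int[n]_(y in B) `|zeta y|.
Proof.
move=> Fe; rewrite -RintegralB//; [|exact: kernel_integrable..].
have Fb y : B y ->
    `|F (t, y) * zeta y - F (t0, y) * zeta y| <= e * `|zeta y|.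
  by move=> By; rewrite -mulrBl normrM ler_wpM2r// Fe.
have mF : measurable_fun (B : set (borel Y))
    (fun y : borel Y => F (t, y) * zeta y - F (t0, y) * zeta y).
  by apply: measurable_funB; exact: kernel_measurable.
by have [] := dominated_Rintegral mB mF iz Fb.
Qed.

Lemma continuous_kernel_integral :
  continuous (fun t => \int[n]_(y in B) (F (t, y) * zeta y) : R).
Proof.
move=> t0; apply/cvgrPdist_lt => e e0 /=.
set Z := \int[n]_(y in B) `|zeta y|.
have Z0 : 0 <= Z by apply: Rintegral_ge0.
have d0 : 0 < e / (Z + 1) by rewrite divr_gt0// ltr_wpDl.
apply: filterS (near_uniform t0 cF cB d0) => t Ft.
rewrite distrC (le_lt_trans (kernel_integral_near (e := e / (Z + 1)) _))//.
  by move=> y By; exact/ltW/Ft.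
rewrite mulrAC ltr_pdivrMr ?ltr_wpDl// ltr_pM2l// ltrDl//.
Qed.

End weighted.

Section fubini.
Variables (R : realType) (X Y : ptopologicalType).
Variables (m : {measure set (borel X) -> \bar R}).
Variables (n : {measure set (borel Y) -> \bar R}).
Variables (F : X * Y -> R) (A : set X) (B : set Y) (zeta : Y -> R).
Hypotheses (cF : continuous F).
Hypotheses (hX : hausdorff_space X) (hY : hausdorff_space Y).
Hypotheses (cA : compact A) (cB : compact B).
Hypothesis (iz : n.-integrable B (EFin \o zeta)).
Implicit Type xi : X -> R.

Let a x := \int[n]_(y in B) (F (x, y) * zeta y).
Let b xi y := \int[m]_(x in A) (F (x, y) * xi x).
Let mA : measurable (A : set (borel X)). Proof. exact: compact_borel. Qed.
Let mB : measurable (B : set (borel Y)). Proof. exact: compact_borel. Qed.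

Let G (z : Y * X) := F (z.2, z.1).
Let cG : continuous G.
Proof.
move=> z; apply: (@continuous_comp _ _ _ (fun z => (z.2, z.1)) F); last exact: cF.
by apply: cvg_pair; [exact: cvg_snd|exact: cvg_fst].
Qed.

Let intM (U : ptopologicalType) (p : {measure set (borel U) -> \bar R})
    (K : set U) (f g : U -> R) : hausdorff_space U -> compact K ->
  continuous f -> p.-integrable K (EFin \o g) ->
  p.-integrable K (EFin \o (fun u => f u * g u)).
Proof.
move=> hU cK cf ig.
apply: (@kernel_integrable R U U p (fun z => f z.2) K g _ hU cK ig point).
move=> z; apply: (@continuous_comp _ _ _ snd f); last exact: cf.
exact: cvg_snd.
Qed.

Let ca : continuous a.
Proof. exact: continuous_kernel_integral. Qed.

Let cb xi : m.-integrable A (EFin \o xi) -> continuous (b xi).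
Proof.
by move=> ix; apply: (@continuous_kernel_integral R Y X m G A xi cG hX cA ix).
Qed.

(** The difference between the two iterated integrals.  It is additive in the
    weight xi, so it may be estimated on small pieces of A. *)
Let defect xi := \int[m]_(x in A) (a x * xi x) - \int[n]_(y in B) (b xi y * zeta y).

Let defectD xi xi' : m.-integrable A (EFin \o xi) -> m.-integrable A (EFin \o xi') ->
  defect (fun x => xi x + xi' x) = defect xi + defect xi'.
Proof.
move=> i1 i2; rewrite /defect.
have -> : \int[m]_(x in A) (a x * (xi x + xi' x)) =
    \int[m]_(x in A) (a x * xi x) + \int[m]_(x in A) (a x * xi' x).
  rewrite -RintegralD//; [|exact: intM..].
  by apply: eq_Rintegral => x _; rewrite mulrDr.
have -> : \int[n]_(y in B) (b (fun x => xi x + xi' x) y * zeta y) =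
    \int[n]_(y in B) (b xi y * zeta y) + \int[n]_(y in B) (b xi' y * zeta y).
  rewrite -RintegralD//; [|exact: intM (cb _) _..].
  apply: eq_Rintegral => y _; rewrite -mulrDl /b -RintegralD//; last 2 first.
  - exact: (@kernel_integrable R Y X m G A xi cG hX cA i1).
  - exact: (@kernel_integrable R Y X m G A xi' cG hX cA i2).
  by congr (_ * _); apply: eq_Rintegral => x _; rewrite mulrDr.
ring.
Qed.

(** Where xi does not vanish, F is within e of the slice F (x0, -), and the
    iterated integrals of a function of y alone agree. *)
Let defect_local xi (e : R) (x0 : X) : m.-integrable A (EFin \o xi) ->
  (forall x y, A x -> xi x != 0 -> B y -> `|F (x, y) - F (x0, y)| <= e) ->
  `|defect xi| <= (e * \int[n]_(y in B) `|zeta y|) * \int[m]_(x in A) `|xi x| *+ 2.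
Proof.
move=> ix Fe; set Z := \int[n]_(y in B) `|zeta y|.
set N := \int[m]_(x in A) `|xi x|.
set I := \int[m]_(x in A) xi x.
have h1 : `|\int[m]_(x in A) (a x * xi x) - a x0 * I| <= e * Z * N.
  rewrite -RintegralZl// -RintegralB//; last 2 first.
  - exact: intM.
  - by apply: intM => //; exact: cst_continuous.
  have Hb x : A x -> `|a x * xi x - a x0 * xi x| <= e * Z * `|xi x|.
    move=> Ax; rewrite -mulrBl normrM.
    have [->|xi0] := eqVneq (xi x) 0; first by rewrite normr0 !mulr0.
    rewrite ler_wpM2r// /a.
    apply: (@kernel_integral_near R X Y n F B zeta cF hY cB iz x x0 e) => y By.
    exact: Fe.
  have mH : measurable_fun (A : set (borel X))
      (fun x : borel X => a x * xi x - a x0 * xi x).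
    apply: measurable_funB; apply: (@integrable_measurable R X m).
      exact: intM.
    by apply: intM => //; exact: cst_continuous.
  by have [] := dominated_Rintegral mA mH ix Hb.
have iF : n.-integrable B (EFin \o (fun y => F (x0, y) * zeta y * I)).
  rewrite (_ : _ \o _ = EFin \o (fun y => (F (x0, y) * I) * zeta y)).
    apply: intM => // y; apply: cvgMl; exact: (continuous_slicer cF).
  by apply/funext => y /=; rewrite mulrAC.
have h2 : `|\int[n]_(y in B) (b xi y * zeta y) - a x0 * I| <= e * Z * N.
  rewrite /a -RintegralZr//; last exact: kernel_integrable.
  rewrite -RintegralB//; last by apply: intM => //; exact: cb.
  rewrite -(mulrAC e N).
  have Hb y : B y -> `|b xi y * zeta y - F (x0, y) * zeta y * I| <= e * N * `|zeta y|.
    move=> By; rewrite mulrAC -mulrBl normrM ler_wpM2r//.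
    rewrite -RintegralZl// /b -RintegralB//; last 2 first.
    - exact: (@kernel_integrable R Y X m G A xi cG hX cA ix).
    - by apply: intM => //; exact: cst_continuous.
    have Kb x : A x -> `|F (x, y) * xi x - F (x0, y) * xi x| <= e * `|xi x|.
      move=> Ax; rewrite -mulrBl normrM.
      have [->|xi0] := eqVneq (xi x) 0; first by rewrite normr0 !mulr0.
      by rewrite ler_wpM2r// Fe.
    have mK : measurable_fun (A : set (borel X))
        (fun x : borel X => F (x, y) * xi x - F (x0, y) * xi x).
      apply: measurable_funB; apply: (@integrable_measurable R X m).
        exact: (@kernel_integrable R Y X m G A xi cG hX cA ix).
      by apply: intM => //; exact: cst_continuous.
    by have [] := dominated_Rintegral mA mK ix Kb.
  have mH : measurable_fun (B : set (borel Y))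
      (fun y : borel Y => b xi y * zeta y - F (x0, y) * zeta y * I).
    apply: measurable_funB; apply: (@integrable_measurable R Y n).
      by apply: intM => //; exact: cb.
    exact: iF.
  by have [] := dominated_Rintegral mB mH iz Hb.
rewrite /defect mulr2n.
rewrite (_ : _ - _ = (\int[m]_(x in A) (a x * xi x) - a x0 * I) -
   (\int[n]_(y in B) (b xi y * zeta y) - a x0 * I)); last by ring.
by rewrite (le_trans (ler_normB _ _))// lerD.
Qed.

(** Induction on the list of centers: xi is split along the closed set U of the
    points whose slice is e-close to that of the first center. *)
Let defect_cover (e : R) (s : seq X) xi : m.-integrable A (EFin \o xi) ->
  0 <= e ->
  (forall x, A x -> xi x != 0 ->
    exists2 x0, x0 \in s & forall y, B y -> `|F (x, y) - F (x0, y)| <= e) ->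
  `|defect xi| <= (e * \int[n]_(y in B) `|zeta y|) * \int[m]_(x in A) `|xi x| *+ 2.
Proof.
elim: s xi => [|x0 s ih] xi ix e0 xis.
  apply: (defect_local (x0 := point)) => // x y Ax xi0 By.
  by have [] := xis x Ax xi0.
pose U := [set x : X | forall y, B y -> `|F (x, y) - F (x0, y)| <= e].
have cU : closed U.
  rewrite (_ : U = \bigcap_(y in B) [set x | `|F (x, y) - F (x0, y)| <= e]).
    apply: closed_bigI => y By.
    apply: (@closed_comp _ _ (fun x => `|F (x, y) - F (x0, y)|) [set r | r <= e]).
      move=> x _; apply: cvg_norm.
      by apply: cvgB; [exact: (continuous_slicel cF)|exact: cvg_cst].
    exact: closed_le.
  by apply/seteqP; split.
have mU : measurable (U : set (borel X)) by exact: closed_borel.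
pose u := xi \_ U; pose v := xi \_ (~` U).
have xiE : xi = (fun x => u x + v x).
  apply/funext => x; rewrite /u /v !patchE in_setC.
  by case: (x \in U); rewrite ?addr0 ?add0r.
have iu : m.-integrable A (EFin \o u).
  rewrite /u -restrict_EFin; apply/integrable_restrict => //.
  by apply: integrableS ix => //; exact: measurableI.
have iv : m.-integrable A (EFin \o v).
  rewrite /v -restrict_EFin; apply/integrable_restrict => //.
    exact: measurableC.
  apply: integrableS ix => //; apply: measurableI => //; exact: measurableC.
have normE : \int[m]_(x in A) `|xi x| =
    \int[m]_(x in A) `|u x| + \int[m]_(x in A) `|v x|.
  rewrite -RintegralD//; [|exact: (integrable_norm iu)|exact: (integrable_norm iv)].
  apply: eq_Rintegral => x _; rewrite /u /v !patchE in_setC.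
  by case: (x \in U); rewrite ?normr0 ?addr0 ?add0r.
rewrite [in leLHS]xiE defectD// normE mulrDr mulrnDl.
rewrite (le_trans (ler_normD _ _))// lerD//.
  apply: (defect_local (x0 := x0)) => // x y Ax; rewrite /u patchE.
  by case: ifPn => [/set_mem/(_ y)|]; rewrite ?eqxx.
apply: ih => // x Ax; rewrite /v patchE in_setC.
case: (boolP (x \in U)) => /=; rewrite ?eqxx// => xU /(xis x Ax)[x1].
rewrite inE => /orP[/eqP->|x1s] xy; last by exists x1.
by move: xU; rewrite notin_setE => /(_ xy).
Qed.

(** Compactness of A covers it by finitely many sets on which the slices of F
    are uniformly close, so the defect is at most a constant times any positive
    number. *)
Lemma fubini_weighted xi : m.-integrable A (EFin \o xi) ->
  \int[m]_(x in A) (a x * xi x) = \int[n]_(y in B) (b xi y * zeta y).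
Proof.
move=> ix; apply/eqP; rewrite -subr_eq0 -normr_le0; apply/ler_addgt0Pr => e e0.
rewrite add0r.
set C := (\int[n]_(y in B) `|zeta y| * \int[m]_(x in A) `|xi x|) *+ 2.
have C0 : 0 <= C by rewrite mulrn_wge0// mulr_ge0// Rintegral_ge0.
pose d := e / (C + 1).
have d0 : 0 < d by rewrite divr_gt0// ltr_wpDl.
pose U (x0 : X) := interior [set x | forall y, B y -> `|F (x, y) - F (x0, y)| < d].
have : cover_compact A by rewrite -compact_cover.
move=> /(_ X setT U)[|x _|D _ AD].
- by move=> x _; exact: open_interior.
- by exists x => //; exact: near_uniform.
apply: (@le_trans _ _ (d * \int[n]_(y in B) `|zeta y| * \int[m]_(x in A) `|xi x| *+ 2)).
  apply: (defect_cover (s := finmap.enum_fset D)) => //; first exact: ltW.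
  move=> x Ax _; have [x0 /= x0D /interior_subset Ux] := AD x Ax.
  by exists x0 => // y By; exact/ltW/Ux.
rewrite -mulrA -mulrnAr -/C /d mulrAC ler_pdivrMr ?ltr_wpDl// ler_pM2l//.
by rewrite lerDl.
Qed.

End fubini.

(** * Complex-valued functions *)

Local Notation Re := (@complex.Re _).
Local Notation Im := (@complex.Im _).

Section complex_arith.
Variable R : realType.
Implicit Types z w : R[i].

Lemma ReD z w : Re (z + w) = Re z + Re w. Proof. by case: z; case: w. Qed.
Lemma ImD z w : Im (z + w) = Im z + Im w. Proof. by case: z; case: w. Qed.
Lemma ReB z w : Re (z - w) = Re z - Re w. Proof. by case: z; case: w. Qed.
Lemma ImB z w : Im (z - w) = Im z - Im w. Proof. by case: z; case: w. Qed.
Lemma ReM z w : Re (z * w) = Re z * Re w - Im z * Im w.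
Proof. by case: z; case: w. Qed.
Lemma ImM z w : Im (z * w) = Re z * Im w + Im z * Re w.
Proof. by case: z => a b; case: w. Qed.

Lemma complex_eqP z w : Re z = Re w -> Im z = Im w -> z = w.
Proof. by case: z => a b; case: w => c d /= -> ->. Qed.

Lemma normCE z : `|z| = (Re `|z|)%:C%C.
Proof. by rewrite normc_def. Qed.

Lemma Re_normc z : Re `|z| = Num.sqrt (Re z ^+ 2 + Im z ^+ 2).
Proof. by rewrite normc_def. Qed.

Lemma norm_Re z : `|Re z| <= Re `|z|.
Proof. by rewrite Re_normc -sqrtr_sqr ler_sqrt ?lerDl ?addr_ge0 ?sqr_ge0. Qed.

Lemma Re_normc_ge0 z : 0 <= Re `|z|.
Proof. by rewrite Re_normc sqrtr_ge0. Qed.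

Lemma norm_Im z : `|Im z| <= Re `|z|.
Proof. by rewrite Re_normc -sqrtr_sqr ler_sqrt ?lerDr ?addr_ge0 ?sqr_ge0. Qed.

Lemma Re_normc_le z : Re `|z| <= `|Re z| + `|Im z|.
Proof.
rewrite Re_normc -[leRHS]ger0_norm ?addr_ge0// -sqrtr_sqr ler_wsqrtr//.
rewrite sqrrD !real_normK ?num_real//.
by have := mulr_ge0 (normr_ge0 (Re z)) (normr_ge0 (Im z)); lra.
Qed.

Variable T : topologicalType.

Lemma continuous_complexP (f : T -> R[i]) :
  continuous (f : T -> R[i]^o) <->
  continuous (fun x => Re (f x)) /\ continuous (fun x => Im (f x)).
Proof.
split=> [cf|[cR cI]].
  by split=> x; apply/cvgrPdist_lt => e e0;
    have e0' : (0 : R[i]) < e%:C%C by [rewrite ltcR];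
    have /cvgrPdist_lt/(_ _ e0') := cf x; apply: filterS => y /=;
    rewrite normCE ltcR; apply: le_lt_trans; rewrite -?ReB -?ImB;
    [exact: norm_Re|exact: norm_Im].
move=> x; apply/cvgrPdist_lt => e e0.
have [d d0 ->] : exists2 d : R, 0 < d & e = d%:C%C.
  move: e0; rewrite ltcE => /andP[/eqP e0 e1]; exists (Re e) => //.
  by apply: complex_eqP.
have d2 : 0 < d / 2 by rewrite divr_gt0.
have /cvgrPdist_lt/(_ _ d2) h1 := cR x.
have /cvgrPdist_lt/(_ _ d2) h2 := cI x.
near=> y; rewrite normCE ltcR (le_lt_trans (Re_normc_le _))// ReB ImB.
rewrite (splitr d) ltrD//; near: y; [exact: h1|exact: h2].
Unshelve. all: by end_near. Qed.

Lemma continuous_complexM (f g : T -> R[i]) :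
  continuous (f : T -> R[i]^o) -> continuous (g : T -> R[i]^o) ->
  continuous ((fun x => f x * g x) : T -> R[i]^o).
Proof.
move=> /continuous_complexP[fR fI] /continuous_complexP[gR gI].
apply/continuous_complexP; split.
- rewrite (_ : (fun _ => _) = fun x => Re (f x) * Re (g x) - Im (f x) * Im (g x)).
    by move=> x; apply: cvgB; apply: cvgM; [exact: fR|exact: gR|exact: fI|exact: gI].
  by apply/funext => x; rewrite ReM.
- rewrite (_ : (fun _ => _) = fun x => Re (f x) * Im (g x) + Im (f x) * Re (g x)).
    by move=> x; apply: cvgD; apply: cvgM; [exact: fR|exact: gI|exact: fI|exact: gR].
  by apply/funext => x; rewrite ImM.
Qed.

End complex_arith.

Section cintegral_theory.
Variables (R : realType) (T : ptopologicalType).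
Variable m : {measure set (borel T) -> \bar R}.
Implicit Types f g : T -> R[i].

Let intZ (c : R) (u : T -> R) : m.-integrable setT (EFin \o u) ->
  m.-integrable setT (EFin \o (fun x => c * u x)).
Proof.
move=> iu; rewrite (_ : _ \o _ = (fun x => c%:E * (EFin \o u) x)%E).
  exact: integrableZl.
by apply/funext => x /=; rewrite EFinM.
Qed.

Let intD (u v : T -> R) : m.-integrable setT (EFin \o u) ->
  m.-integrable setT (EFin \o v) ->
  m.-integrable setT (EFin \o (fun x => u x + v x)).
Proof. by move=> iu iv; apply: (integrableD measurableT iu iv). Qed.

Let intB (u v : T -> R) : m.-integrable setT (EFin \o u) ->
  m.-integrable setT (EFin \o v) ->
  m.-integrable setT (EFin \o (fun x => u x - v x)).
Proof. by move=> iu iv; apply: (integrableB measurableT iu iv). Qed.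

Lemma cintegrableZ a f : cintegrable m f -> cintegrable m (fun x => a * f x).
Proof.
move=> [fR fI]; split.
- rewrite (_ : (fun _ => _) = EFin \o (fun x => Re a * Re (f x) - Im a * Im (f x))).
    exact: intB (intZ _ fR) (intZ _ fI).
  by apply/funext => x /=; rewrite ReM.
- rewrite (_ : (fun _ => _) = EFin \o (fun x => Re a * Im (f x) + Im a * Re (f x))).
    exact: intD (intZ _ fI) (intZ _ fR).
  by apply/funext => x /=; rewrite ImM.
Qed.

Lemma cintegralZ a f : cintegrable m f ->
  cintegral m (fun x => a * f x) = a * cintegral m f.
Proof.
move=> [fR fI]; apply: complex_eqP; rewrite ?ReM ?ImM /=.
- rewrite -!RintegralZl// -RintegralB//; [|exact: intZ..].
  by apply: eq_Rintegral => x _; rewrite ReM.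
- rewrite -!RintegralZl// -RintegralD//; [|exact: intZ..].
  by apply: eq_Rintegral => x _; rewrite ImM.
Qed.

Lemma cintegralD f g : cintegrable m f -> cintegrable m g ->
  cintegral m (fun x => f x + g x) = cintegral m f + cintegral m g.
Proof.
move=> [fR fI] [gR gI]; apply: complex_eqP; rewrite ?ReD ?ImD /=.
- by rewrite -RintegralD//; apply: eq_Rintegral => x _; rewrite ReD.
- by rewrite -RintegralD//; apply: eq_Rintegral => x _; rewrite ImD.
Qed.

End cintegral_theory.

Section square_integrable.
Variables (R : realType) (T : ptopologicalType).
Variable m : {measure set (borel T) -> \bar R}.
Hypothesis mT : (m setT < +oo)%E.
Implicit Types f g : T -> R[i].

Lemma measurable_normc f :
  measurable_fun setT (fun x : borel T => Re (f x)) ->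
  measurable_fun setT (fun x : borel T => Im (f x)) ->
  measurable_fun setT (fun x : borel T => Re `|f x|).
Proof.
move=> mR mI.
rewrite (_ : (fun _ => _) =
    (fun x : borel T => Num.sqrt (Re (f x) ^+ 2 + Im (f x) ^+ 2))).
  apply: (measurableT_comp (continuous_measurable_fun (@sqrt_continuous R))).
  by apply: measurable_funD; exact: measurable_funX.
by apply/funext => x; rewrite Re_normc.
Qed.

Let c0 : R := fine (m setT `^ 2^-1)%E.

Let c0E : (m setT `^ 2^-1)%E = c0%:E.
Proof. by rewrite fineK// fin_num_poweR// ge0_fin_numE. Qed.

Let c0_ge0 : 0 <= c0. Proof. by rewrite fine_ge0// poweR_ge0. Qed.

(** Hoelder's inequality against the constant 1. *)
Lemma L1_le_L2norm f : L2 m f ->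
  (\int[m]_x (Re `|f x|)%:E <= c0%:E * L2norm m f)%E.
Proof.
move=> [mR mI _]; have mf := measurable_normc mR mI.
have half : 2^-1 + 2^-1 = 1 :> R by rewrite [RHS]splitr !div1r.
have := hoelder m mf (@measurable_cst _ _ (borel T) R setT 1)
  (ltr0n R 2) (ltr0n R 2) half.
rewrite Lnorm1 -[X in (_ <= _ * X)%E]/(Lnorm m 2%:E (cst 1%E)) Lnorm_cst1 c0E.
rewrite [X in (_ <= X)%E]muleC; apply: le_trans.
apply: ge0_le_integral => //=.
- by move=> x _; rewrite lee_fin Re_normc_ge0.
- exact/measurable_EFinP.
- apply/measurable_EFinP; apply: measurableT_comp => //.
  by apply: measurable_funM => //; exact: mf.
- by move=> x _; rewrite mulr1 lee_fin ler_norm.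
Qed.

Lemma L2_integrable_normc f : L2 m f -> m.-integrable setT (fun x => (Re `|f x|)%:E).
Proof.
move=> L2f; have [mR mI f2] := L2f; apply/integrableP; split.
  by apply/measurable_EFinP; exact: measurable_normc.
under eq_integral => x _ do
  rewrite gee0_abs ?lee_fin ?Re_normc_ge0//.
apply: le_lt_trans (L1_le_L2norm L2f) _.
by rewrite lte_mul_pinfty// lee_fin.
Qed.

Lemma L2_cintegrable f : L2 m f -> cintegrable m f.
Proof.
move=> L2f; have [mR mI _] := L2f; have iN := L2_integrable_normc L2f.
split; apply: le_integrable iN => //; [exact/measurable_EFinP| |
  exact/measurable_EFinP|] => x _; rewrite !abse_EFin lee_fin;
  rewrite [leRHS]ger0_norm ?Re_normc_ge0//.
  exact: norm_Re.
exact: norm_Im.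
Qed.

Lemma L2norm_bounded g c : 0 <= c -> (forall x, Re `|g x| <= c) ->
  measurable_fun setT (fun x : borel T => Re (g x)) ->
  measurable_fun setT (fun x : borel T => Im (g x)) ->
  (L2norm m g <= (c * c0)%:E)%E.
Proof.
move=> c_ge0 gc mR mI; rewrite /L2norm unlock EFinM -c0E.
have -> : (c%:E = (c ^+ 2)%:E `^ 2^-1)%E.
  by rewrite poweR_EFin -powR_mulrn// -powRrM mulfV// powRr1.
rewrite -poweRM// ?lee_fin ?sqr_ge0//.
apply: gt0_ler_poweR => //.
- by rewrite in_itv/= leey integral_ge0.
- by rewrite in_itv/= leey mule_ge0// lee_fin sqr_ge0.
rewrite -[in leRHS]integral_cst//; apply: ge0_le_integral => //.
- by move=> x _; rewrite lee_fin powR_ge0.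
- apply/measurable_EFinP.
  apply: (@measurableT_comp _ _ _ _ _ _ (@powR R ^~ 2)) => //.
  by apply: measurableT_comp => //; exact: measurable_normc.
move=> x _; rewrite lee_fin powR_mulrn//.
by rewrite ler_sqr ?nnegrE// ger0_norm ?Re_normc_ge0.
Qed.

Lemma bounded_L2 g c : 0 <= c -> (forall x, Re `|g x| <= c) ->
  measurable_fun setT (fun x : borel T => Re (g x)) ->
  measurable_fun setT (fun x : borel T => Im (g x)) -> L2 m g.
Proof.
move=> c_ge0 gc mR mI; split=> //.
by apply: le_lt_trans (L2norm_bounded c_ge0 gc mR mI) _; rewrite ltry.
Qed.

End square_integrable.

(** * Integral operators with a continuous kernel *)

Section kernel_operator.
Variables (R : realType) (T Y : ptopologicalType).
Variable m : {measure set (borel Y) -> \bar R}.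
Variable K : T * Y -> R[i].
Hypotheses (hY : hausdorff_space Y) (cY : compact [set: Y]).
Hypothesis cK : continuous (K : T * Y -> R[i]^o).
Implicit Types xi : Y -> R[i].

Let cKR : continuous (fun z => Re (K z)). Proof. exact: ((continuous_complexP K).1 cK).1. Qed.
Let cKI : continuous (fun z => Im (K z)). Proof. exact: ((continuous_complexP K).1 cK).2. Qed.

Lemma kernel_cintegrable t xi : cintegrable m xi ->
  cintegrable m (fun y => K (t, y) * xi y).
Proof.
move=> [xR xI].
pose k1 := @kernel_integrable R T Y m _ setT _ cKR hY cY xR t.
pose k2 := @kernel_integrable R T Y m _ setT _ cKI hY cY xI t.
pose k3 := @kernel_integrable R T Y m _ setT _ cKR hY cY xI t.
pose k4 := @kernel_integrable R T Y m _ setT _ cKI hY cY xR t.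
split.
- have := integrableB measurableT k1 k2.
  by congr (integrable _ _ _); apply/funext => y /=; rewrite ReM.
- have := integrableD measurableT k3 k4.
  by congr (integrable _ _ _); apply/funext => y /=; rewrite ImM.
Qed.

Definition kernel_op xi t := cintegral m (fun y => K (t, y) * xi y).

Lemma Re_kernel_op xi t : cintegrable m xi -> Re (kernel_op xi t) =
  \int[m]_y (Re (K (t, y)) * Re (xi y)) - \int[m]_y (Im (K (t, y)) * Im (xi y)).
Proof.
move=> [xR xI]; rewrite -RintegralB//.
- by apply: eq_Rintegral => y _; rewrite ReM.
- exact: (@kernel_integrable R T Y m _ setT _ cKR hY cY xR t).
- exact: (@kernel_integrable R T Y m _ setT _ cKI hY cY xI t).
Qed.

Lemma Im_kernel_op xi t : cintegrable m xi -> Im (kernel_op xi t) =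
  \int[m]_y (Re (K (t, y)) * Im (xi y)) + \int[m]_y (Im (K (t, y)) * Re (xi y)).
Proof.
move=> [xR xI]; rewrite -RintegralD//.
- by apply: eq_Rintegral => y _; rewrite ImM.
- exact: (@kernel_integrable R T Y m _ setT _ cKR hY cY xI t).
- exact: (@kernel_integrable R T Y m _ setT _ cKI hY cY xR t).
Qed.

Lemma kernel_op_continuous xi : cintegrable m xi ->
  continuous (kernel_op xi : T -> R[i]^o).
Proof.
move=> ix; have [xR xI] := ix; apply/continuous_complexP; split.
  rewrite (_ : (fun _ => _) = (fun t =>
    \int[m]_y (Re (K (t, y)) * Re (xi y)) -
    \int[m]_y (Im (K (t, y)) * Im (xi y)))); last first.
    by apply/funext => t; exact: Re_kernel_op.
  move=> t; apply: cvgB.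
  - exact: (@continuous_kernel_integral R T Y m _ setT _ cKR hY cY xR).
  - exact: (@continuous_kernel_integral R T Y m _ setT _ cKI hY cY xI).
rewrite (_ : (fun _ => _) = (fun t =>
    \int[m]_y (Re (K (t, y)) * Im (xi y)) +
    \int[m]_y (Im (K (t, y)) * Re (xi y)))); last first.
  by apply/funext => t; exact: Im_kernel_op.
move=> t; apply: cvgD.
- exact: (@continuous_kernel_integral R T Y m _ setT _ cKR hY cY xI).
- exact: (@continuous_kernel_integral R T Y m _ setT _ cKI hY cY xR).
Qed.

(** Splitting into real and imaginary parts produces four real integrals, which
    is where the factor 4 comes from. *)
Lemma kernel_op_bound xi t c : cintegrable m xi ->
  (forall y, Re `|K (t, y)| <= c) ->
  m.-integrable setT (fun y => (Re `|xi y|)%:E) ->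
  Re `|kernel_op xi t| <= 4 * c * \int[m]_y Re `|xi y|.
Proof.
move=> ix Kc iN; have [xR xI] := ix.
have bound (p q : Y -> R) : (forall y, `|p y| <= c) ->
    m.-integrable setT (EFin \o (fun y => p y * q y)) ->
    (forall y, `|q y| <= Re `|xi y|) ->
    `|\int[m]_y (p y * q y)| <= c * \int[m]_y Re `|xi y|.
  move=> pc ipq qxi.
  have h y : setT y -> `|p y * q y| <= c * `|Re `|xi y| |.
    by move=> _; rewrite normrM ler_pM// (le_trans (qxi y))// ler_norm.
  have [_] := dominated_Rintegral measurableT (integrable_measurable ipq) iN h.
  move=> /le_trans; apply; rewrite le_eqVlt; apply/orP; left; apply/eqP.
  by congr (_ * _); apply: eq_Rintegral => y _; rewrite ger0_norm// Re_normc_ge0.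
have KR y : `|Re (K (t, y))| <= c by rewrite (le_trans (norm_Re _)).
have KI y : `|Im (K (t, y))| <= c by rewrite (le_trans (norm_Im _)).
have xR' y : `|Re (xi y)| <= Re `|xi y| by exact: norm_Re.
have xI' y : `|Im (xi y)| <= Re `|xi y| by exact: norm_Im.
have b1 := bound _ _ KR (@kernel_integrable R T Y m _ setT _ cKR hY cY xR t) xR'.
have b2 := bound _ _ KI (@kernel_integrable R T Y m _ setT _ cKI hY cY xI t) xI'.
have b3 := bound _ _ KR (@kernel_integrable R T Y m _ setT _ cKR hY cY xI t) xI'.
have b4 := bound _ _ KI (@kernel_integrable R T Y m _ setT _ cKI hY cY xR t) xR'.
rewrite (le_trans (Re_normc_le _))// Re_kernel_op// Im_kernel_op//.
rewrite (_ : 4 * c * _ = (c * \int[m]_y Re `|xi y| + c * \int[m]_y Re `|xi y|) +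
  (c * \int[m]_y Re `|xi y| + c * \int[m]_y Re `|xi y|)); last by ring.
apply: lerD.
  by rewrite (le_trans (ler_normB _ _))// lerD.
by rewrite (le_trans (ler_normD _ _))// lerD.
Qed.

End kernel_operator.

Section complex_fubini.
Variables (R : realType) (T Y : ptopologicalType).
Variable m : {measure set (borel T) -> \bar R}.
Variable n : {measure set (borel Y) -> \bar R}.
Variable K : T * Y -> R[i].
Hypotheses (hT : hausdorff_space T) (cT : compact [set: T]).
Hypotheses (hY : hausdorff_space Y) (cY : compact [set: Y]).
Hypothesis mT : (m setT < +oo)%E.
Hypothesis cK : continuous (K : T * Y -> R[i]^o).

Let cKR : continuous (fun z => Re (K z)). Proof. exact: ((continuous_complexP K).1 cK).1. Qed.
Let cKI : continuous (fun z => Im (K z)). Proof. exact: ((continuous_complexP K).1 cK).2. Qed.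

Let i1 : m.-integrable setT (EFin \o (fun=> 1)).
Proof. by apply: continuous_integrable => //; exact: cst_continuous. Qed.

Let real_swap (F : T * Y -> R) (xi : Y -> R) : continuous F ->
  n.-integrable setT (EFin \o xi) ->
  \int[m]_t (\int[n]_y (F (t, y) * xi y)) =
  \int[n]_y ((\int[m]_t F (t, y)) * xi y).
Proof.
move=> cF ix.
have := @fubini_weighted R T Y m n F setT setT xi cF hT hY cT cY ix (fun=> 1) i1.
under eq_Rintegral do rewrite mulr1.
move=> ->; apply: eq_Rintegral => y _; congr (_ * _).
by apply: eq_Rintegral => t _; rewrite mulr1.
Qed.

(** Fubini's theorem for each of the four products of real and imaginary
    parts. *)
Lemma cintegral_swap (xi : Y -> R[i]) : cintegrable n xi ->
  cintegral m (fun t => cintegral n (fun y => K (t, y) * xi y)) =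
  cintegral n (fun y => cintegral m (fun t => K (t, y)) * xi y).
Proof.
move=> ix; have [xR xI] := ix.
have iop (F : T * Y -> R) (u : Y -> R) : continuous F ->
    n.-integrable setT (EFin \o u) ->
    m.-integrable setT (EFin \o (fun t => \int[n]_y (F (t, y) * u y))).
  move=> cF iu; apply: continuous_integrable => //.
  exact: (@continuous_kernel_integral R T Y n F setT u cF hY cY iu).
have iop' (F : T * Y -> R) (u : Y -> R) : continuous F ->
    n.-integrable setT (EFin \o u) ->
    n.-integrable setT (EFin \o (fun y => (\int[m]_t F (t, y)) * u y)).
  move=> cF iu.
  have cF' : continuous (fun z : Y * T => F (z.2, z.1)).
    move=> z; apply: (@continuous_comp _ _ _ (fun z => (z.2, z.1)) F); last exact: cF.
    by apply: cvg_pair; [exact: cvg_snd|exact: cvg_fst].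
  have cI := @continuous_kernel_integral R Y T m _ setT (fun=> 1) cF' hT cT i1.
  have cG : continuous (fun z : Y * Y => \int[m]_t F (t, z.2)).
    move=> z; apply: (@continuous_comp _ _ _ snd (fun y => \int[m]_t F (t, y))).
      exact: cvg_snd.
    have := cI z.2; under eq_fun do under eq_Rintegral do rewrite mulr1.
    done.
  exact: (@kernel_integrable R Y Y n _ setT u cG hY cY iu point).
apply: complex_eqP => /=.
- transitivity (\int[m]_t (\int[n]_y (Re (K (t, y)) * Re (xi y)) -
      \int[n]_y (Im (K (t, y)) * Im (xi y)))).
    by apply: eq_Rintegral => t _; exact: (Re_kernel_op hY cY cK).
  rewrite (RintegralB measurableT (iop _ _ cKR xR) (iop _ _ cKI xI)).
  rewrite (real_swap cKR xR) (real_swap cKI xI).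
  rewrite -(RintegralB measurableT (iop' _ _ cKR xR) (iop' _ _ cKI xI)).
  by apply: eq_Rintegral => y _; rewrite ReM.
- transitivity (\int[m]_t (\int[n]_y (Re (K (t, y)) * Im (xi y)) +
      \int[n]_y (Im (K (t, y)) * Re (xi y)))).
    by apply: eq_Rintegral => t _; exact: (Im_kernel_op hY cY cK).
  rewrite (RintegralD measurableT (iop _ _ cKR xI) (iop _ _ cKI xR)).
  rewrite (real_swap cKR xI) (real_swap cKI xR).
  rewrite -(RintegralD measurableT (iop' _ _ cKR xI) (iop' _ _ cKI xR)).
  by apply: eq_Rintegral => y _; rewrite ImM.
Qed.

End complex_fubini.

(** * Change of variables *)

Section change_of_variables.
Variables (R : realType) (T T' : ptopologicalType).
Variables (m : {measure set (borel T) -> \bar R}).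
Variables (m' : {measure set (borel T') -> \bar R}) (theta : T -> T').
Hypothesis mtheta : measurable_fun setT (theta : borel T -> borel T').
Hypothesis mE : forall A : set (borel T'), measurable A -> m (theta @^-1` A) = m' A.

Lemma ge0_integral_image (f : borel T' -> \bar R) : measurable_fun setT f ->
  (forall y, 0 <= f y)%E -> (\int[m']_y f y = \int[m]_x f (theta x))%E.
Proof.
move=> mf f0.
have := @ge0_integral_pushforward _ _ (borel T) (borel T') R theta mtheta m setT f
  measurableT mf (fun y _ => f0 y).
rewrite preimage_setT => <-; apply: eq_measure_integral => A mA _.
exact/esym/mE.
Qed.

Lemma Rintegral_image (f : T' -> R) : measurable_fun setT (f : borel T' -> R) ->
  \int[m]_x f (theta x) = \int[m']_y f y.
Proof.
move=> mf; congr fine; rewrite [LHS]integralE [RHS]integralE.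
have mf' : measurable_fun setT (EFin \o f : borel T' -> \bar R).
  exact/measurable_EFinP.
congr (_ - _)%E; apply/esym.
- rewrite [LHS](ge0_integral_image (measurable_funepos mf') (funepos_ge0 _)).
  by apply: eq_integral => x _; rewrite !funeposE.
- rewrite [LHS](ge0_integral_image (measurable_funeneg mf') (funeneg_ge0 _)).
  by apply: eq_integral => x _; rewrite !funenegE.
Qed.

Lemma cintegral_image (f : T' -> R[i]) :
  measurable_fun setT (fun x : borel T' => Re (f x)) ->
  measurable_fun setT (fun x : borel T' => Im (f x)) ->
  cintegral m (fun x => f (theta x)) = cintegral m' f.
Proof.
move=> mR mI; apply: complex_eqP => /=.
- exact: (Rintegral_image mR).
- exact: (Rintegral_image mI).
Qed.

End change_of_variables.

(** * The space of cosets *)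

Section topological_group.
Variable G : topologicalGroupType.

Lemma continuous_mulg (T : topologicalType) (f g : T -> G) :
  continuous f -> continuous g -> continuous (fun t => (f t * g t)%g).
Proof.
move=> cf cg t.
apply: (@continuous_comp _ _ _ (fun t => (f t, g t))
  (fun z : G * G => (z.1 * z.2)%g)); last exact: mulg_continuous.
by apply: cvg_pair; [exact: cf|exact: cg].
Qed.

Lemma continuous_invg (T : topologicalType) (f : T -> G) :
  continuous f -> continuous (fun t => (f t)^-1%g).
Proof.
move=> cf t; apply: (@continuous_comp _ _ _ f (fun x => x^-1)%g).
  exact: cf.
exact: invg_continuous.
Qed.

Lemma continuous_mull (g : G) : continuous (fun x : G => (g * x)%g).
Proof.
by apply: (@continuous_mulg G (fun=> g) id) => x; [exact: cvg_cst|exact: cvg_id].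
Qed.

Lemma continuous_mulr (g : G) : continuous (fun x : G => (x * g)%g).
Proof.
by apply: (@continuous_mulg G id (fun=> g)) => x; [exact: cvg_id|exact: cvg_cst].
Qed.

Lemma continuous_div : continuous (fun z : G * G => (z.1 * z.2^-1)%g).
Proof.
apply: (@continuous_mulg _ fst (fun z => z.2^-1)%g) => z; first exact: cvg_fst.
by apply: (@continuous_invg _ snd) => {}z; exact: cvg_snd.
Qed.

End topological_group.

Section coset_topology.
Variables (G : topologicalGroupType) (H : subgroup G).
Local Notation X := (coset_space H).
Local Notation pi := (rcoset H).

Lemma subgroupV x : (H : set G) x -> (H : set G) x^-1%g.
Proof. by move=> /mem_set hx; exact/set_mem/(group_closedV (subgroup_closed H)). Qed.

Lemma rcoset_eqP x y : pi x = pi y <-> (H : set G) (x * y^-1)%g.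
Proof.
split=> [/eqmodP/set_mem//|Hxy]; apply/eqmodP; exact: mem_set.
Qed.

Lemma rcoset_mull h x : (H : set G) h -> pi (h * x)%g = pi x.
Proof. by move=> Hh; apply/rcoset_eqP; rewrite mulgK. Qed.

Lemma rcoset_repr u : pi (repr u) = u.
Proof. exact: reprK. Qed.

Lemma repr_rcoset x : exists2 h, (H : set G) h & repr (pi x) = (h * x)%g.
Proof.
exists (repr (pi x) * x^-1)%g; last by rewrite mulgVK.
by apply/rcoset_eqP; rewrite rcoset_repr.
Qed.

Lemma rcoset_continuous : continuous pi.
Proof. exact: pi_continuous. Qed.

(** The saturation of U is the union of its left translates by H. *)
Lemma rcoset_open (U : set G) : open U -> open (pi @` U).
Proof.
move=> oU; rewrite /open/= /quotient_open.
rewrite (_ : _ @^-1` _ = \bigcup_(h in (H : set G)) [set x | U (h * x)%g]).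
  apply: bigcup_open => h _.
  apply: (@open_comp _ _ (fun x => (h * x)%g) U) => // x _.
  exact: continuous_mull.
apply/seteqP; split=> [x [y Uy /rcoset_eqP yx]|x [h Hh Uhx]].
  by exists (y * x^-1)%g => //=; rewrite mulgVK.
by exists (h * x)%g => //; exact: rcoset_mull.
Qed.

Lemma nbhs_rcoset x (U : set G) : nbhs x U -> nbhs (pi x) (pi @` U).
Proof.
rewrite nbhsE => -[V [oV Vx] VU]; apply: filterS (image_subset _ VU) _.
by apply: open_nbhs_nbhs; split; [exact: rcoset_open|exists x].
Qed.

(** Distinct cosets Hx and Hy are separated by the images of neighborhoods U of
    x and V of y such that U V^-1 avoids the closed set H. *)
Lemma coset_space_hausdorff : closed (H : set G) -> hausdorff_space X.
Proof.
move=> cH u v uv; apply: contrapT => neq.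
have nH : ~ (H : set G) (repr u * (repr v)^-1)%g.
  by move=> /rcoset_eqP; rewrite !rcoset_repr.
have nHn : nbhs (repr u * (repr v)^-1)%g (~` (H : set G)).
  by apply: open_nbhs_nbhs; split => //; exact: closed_openC.
have [[U V] /= [nU nV] UV] :=
  @continuous_div G (repr u, repr v) (~` (H : set G)) nHn.
have nU' : nbhs u (pi @` U) by rewrite -(rcoset_repr u); exact: nbhs_rcoset.
have nV' : nbhs v (pi @` V) by rewrite -(rcoset_repr v); exact: nbhs_rcoset.
have [w [[x Ux xw] [y Vy yw]]] := uv _ _ nU' nV'.
by apply: (UV (x, y) (conj Ux Vy)) => /=; apply/rcoset_eqP; rewrite xw yw.
Qed.

Lemma continuous_on_cosets (Z : topologicalType) (f : G -> Z) :
  continuous f -> (forall x y, pi x = pi y -> f x = f y) ->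
  continuous (fun u : X => f (repr u)).
Proof.
move=> cf fE u W /= nW.
have nU : nbhs (repr u) (f @^-1` W) by exact: cf.
have := nbhs_rcoset nU; rewrite rcoset_repr; apply: filterS => v [x /= Wx <-].
by rewrite /= (fE _ x) ?rcoset_repr.
Qed.

(** The product of two quotient maps need not be a quotient map; here it is
    because [rcoset] is open. *)
Lemma continuous2_on_cosets (Z : topologicalType) (F : G * G -> Z) :
  continuous F ->
  (forall x x' y y', pi x = pi x' -> pi y = pi y' -> F (x, y) = F (x', y')) ->
  continuous (fun z : X * X => F (repr z.1, repr z.2)).
Proof.
move=> cF FE [u v] W /= nW.
have [[U V] /= [nU nV] UV] : nbhs (repr u, repr v) (F @^-1` W) by exact: cF.
have nU' := nbhs_rcoset nU; have nV' := nbhs_rcoset nV.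
exists (pi @` U, pi @` V) => /=; first by rewrite -{1}(rcoset_repr u) -{1}(rcoset_repr v).
move=> [u' v'] /= [[x Ux <-] [y Vy <-]].
by rewrite /= (FE _ x _ y) ?rcoset_repr//; exact: (UV (x, y)).
Qed.

Lemma coset_act_rcoset x g : coset_act (pi x) g = pi (x * g)%g.
Proof.
rewrite /coset_act; have [h Hh ->] := repr_rcoset x.
rewrite -mulgA; exact: rcoset_mull.
Qed.

Lemma coset_actK g : cancel (fun u : X => coset_act u g) (fun u => coset_act u g^-1%g).
Proof.
by move=> u; rewrite -(rcoset_repr u) !coset_act_rcoset mulgK.
Qed.

Lemma coset_actVK g : cancel (fun u : X => coset_act u g^-1%g) (fun u => coset_act u g).
Proof.
by move=> u; rewrite -(rcoset_repr u) !coset_act_rcoset mulgVK.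
Qed.

Lemma coset_act_continuous g : continuous (fun u : X => coset_act u g).
Proof.
apply: (continuous_on_cosets (f := fun x => pi (x * g)%g)).
  move=> x; apply: (@continuous_comp _ _ _ (fun x => (x * g)%g) pi).
    exact: continuous_mulr.
  exact: rcoset_continuous.
by move=> x y xy; rewrite -!coset_act_rcoset xy.
Qed.

End coset_topology.

Local Notation conv := Defs.conv.

(** * The regular representation *)

Section regular_representation.
Variables (R : realType) (G : topologicalGroupType) (H : subgroup G).
Local Notation X := (coset_space H).
Local Notation pi := (rcoset H).
Variable nu : {measure set (borel X) -> \bar R}.
Hypotheses (closedH : closed (H : set G)) (cX : compact [set: X]).
Hypotheses (radon_nu : radon nu) (inv_nu : coset_invariant nu).
Implicit Types f xi : X -> R[i].

Let hX : hausdorff_space X. Proof. exact: coset_space_hausdorff. Qed.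

Let finX : (nu setT < +oo)%E.
Proof. by have [h _ _] := radon_nu; exact: h. Qed.

Lemma coset_act_measure (g : G) (A : set (borel X)) : measurable A ->
  nu ((fun u : X => coset_act u g) @^-1` A) = nu A.
Proof.
move=> mA; rewrite -(inv_nu g^-1%g mA); congr (nu _).
apply/seteqP; split=> [u /= Au|_ [u Au <-]] /=; last by rewrite coset_actVK.
by exists (coset_act u g) => //; rewrite coset_actK.
Qed.

Lemma cintegral_coset_act f (g : G) : continuous (f : X -> R[i]^o) ->
  cintegral nu (fun u => f (coset_act u g)) = cintegral nu f.
Proof.
move=> /continuous_complexP[cR cI].
apply: (cintegral_image (continuous_measurable (@coset_act_continuous _ _ g))).
- exact: coset_act_measure.
- exact: continuous_borel.
- exact: continuous_borel.
Qed.

Definition coset_kernel f (z : X * X) : R[i] :=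
  f (pi (repr z.1 * (repr z.2)^-1)%g).

Lemma hecke_right f x h : hecke_algebra f -> (H : set G) h ->
  f (pi (x * h)%g) = f (pi x).
Proof.
move=> [_ fH] /mem_set Hh.
exact: (fH x (exist _ h Hh : subgroup_type H)).
Qed.

(** Invariance of f under H on both sides makes the kernel independent of the
    representatives. *)
Lemma hecke_kernelE f x y : hecke_algebra f ->
  coset_kernel f (pi x, pi y) = f (pi (x * y^-1)%g).
Proof.
move=> hf; rewrite /coset_kernel /=.
have [h Hh ->] := repr_rcoset H x; have [k Hk ->] := repr_rcoset H y.
rewrite invgM mulgA (hecke_right _ hf (subgroupV Hk)) -mulgA.
by rewrite (rcoset_mull _ Hh).
Qed.

Lemma hecke_continuous f : hecke_algebra f -> continuous (f : X -> R[i]^o).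
Proof. by case=> -[]. Qed.

Lemma coset_kernel_continuous f : hecke_algebra f ->
  continuous (coset_kernel f : X * X -> R[i]^o).
Proof.
move=> hf; apply: (@continuous2_on_cosets _ _ _
  (fun z : G * G => f (pi (z.1 * z.2^-1)%g) : R[i]^o)).
  move=> z; apply: (@continuous_comp _ _ _ (fun z : G * G => pi (z.1 * z.2^-1)%g)
    (f : X -> R[i]^o)); last exact: hecke_continuous.
  apply: continuous_comp; first exact: continuous_div.
  exact: rcoset_continuous.
by move=> x x' y y' xx' yy'; rewrite -!hecke_kernelE// xx' yy'.
Qed.

Lemma convE f xi : conv nu f xi = kernel_op nu (coset_kernel f) xi.
Proof. by []. Qed.

Lemma compactly_supported_coset f :
  continuous (f : X -> R[i]^o) -> compactly_supported f.
Proof.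
move=> cf; split => //.
by apply: (subclosed_compact _ cX) => //; exact: closed_closure.
Qed.

Lemma continuous_bounded f : continuous (f : X -> R[i]^o) ->
  exists2 c : R, 0 <= c & forall u, Re `|f u| <= c.
Proof.
move=> /continuous_complexP[cR cI].
have bound (g : X -> R) : continuous g -> exists c : R, forall u, `|g u| <= c.
  move=> cg; have [M [_ MP]] : bounded_set (g @` setT).
    apply: compact_bounded; apply: continuous_compact => //.
    exact: continuous_subspaceT.
  exists (`|M| + 1) => u; apply: (MP (`|M| + 1)); last by exists u.
  by rewrite (le_lt_trans (ler_norm M))// ltrDl.
have [c1 h1] := bound _ cR; have [c2 h2] := bound _ cI.
exists (c1 + c2).
  by rewrite addr_ge0// (le_trans _ (h1 point), le_trans _ (h2 point)).
by move=> u; rewrite (le_trans (Re_normc_le _))// lerD.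
Qed.

Lemma continuous_L2 f : continuous (f : X -> R[i]^o) -> L2 nu f.
Proof.
move=> cf; have [c c0 fc] := continuous_bounded cf.
have [cR cI] := (continuous_complexP f).1 cf.
by apply: (bounded_L2 finX c0 fc); exact: continuous_borel.
Qed.

Lemma conv_continuous f xi : hecke_algebra f -> cintegrable nu xi ->
  continuous (conv nu f xi : X -> R[i]^o).
Proof.
move=> hf ix; rewrite convE.
exact: (kernel_op_continuous hX cX (coset_kernel_continuous hf) ix).
Qed.

Lemma coset_kernel_bounded f : hecke_algebra f ->
  exists2 c : R, 0 <= c & forall z, Re `|coset_kernel f z| <= c.
Proof.
by move=> /hecke_continuous/continuous_bounded[c c0 fc]; exists c => // z; exact: fc.
Qed.

Lemma conv_bounded_operator f : hecke_algebra f ->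
  L2_bounded_operator nu (conv nu f).
Proof.
move=> hf; have cK := coset_kernel_continuous hf.
split.
- move=> xi /(L2_cintegrable finX) ix; apply: continuous_L2.
  exact: conv_continuous.
- move=> xi xi' L2x L2x' [N [mN N0 Nxi]].
  apply: aeW => u; rewrite !convE.
  have ix := L2_cintegrable finX L2x; have ix' := L2_cintegrable finX L2x'.
  have [kR kI] := kernel_cintegrable hX cX cK u ix.
  have [kR' kI'] := kernel_cintegrable hX cX cK u ix'.
  apply: complex_eqP => /=; congr fine; apply: ae_eq_integral => //.
  + exact: measurable_int kR.
  + exact: measurable_int kR'.
  + by exists N; split=> // v nxx; apply: Nxi => xx; apply: nxx => _ /=; rewrite xx.
  + exact: measurable_int kI.
  + exact: measurable_int kI'.
  + by exists N; split=> // v nxx; apply: Nxi => xx; apply: nxx => _ /=; rewrite xx.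
- move=> a xi xi' L2x L2x'; apply: aeW => u; rewrite !convE /kernel_op.
  have ix := L2_cintegrable finX L2x; have ix' := L2_cintegrable finX L2x'.
  have k := kernel_cintegrable hX cX cK u ix.
  have k' := kernel_cintegrable hX cX cK u ix'.
  rewrite -(cintegralZ a k) -(cintegralD (cintegrableZ a k) k').
  by congr cintegral; apply/funext => v; ring.
- have [c c0 fc] := coset_kernel_bounded hf.
  set d := fine (nu setT `^ 2^-1)%E.
  have d0 : 0 <= d by rewrite fine_ge0// poweR_ge0.
  exists (4 * c * d * d) => xi L2x.
  have ix := L2_cintegrable finX L2x.
  have iN := L2_integrable_normc finX L2x.
  have cA := (continuous_complexP _).1 (conv_continuous hf ix).
  set N := \int[nu]_v Re `|xi v|.
  have N0 : 0 <= N by apply: Rintegral_ge0 => v _; exact: Re_normc_ge0.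
  have Ab u : Re `|conv nu f xi u| <= 4 * c * N.
    by rewrite convE; exact: (kernel_op_bound hX cX cK ix (fun y => fc (u, y)) iN).
  have b0 : 0 <= 4 * c * N by rewrite !mulr_ge0.
  apply: le_trans (L2norm_bounded finX b0 Ab (continuous_borel cA.1)
    (continuous_borel cA.2)) _.
  rewrite -/d (_ : 4 * c * N * d = (4 * c * d) * N); last by ring.
  rewrite EFinM (EFinM (4 * c * d)) -muleA; apply: lee_pmul.
  + by rewrite lee_fin !mulr_ge0.
  + by rewrite lee_fin.
  + by [].
  + have := L1_le_L2norm finX L2x; rewrite -/d; apply: le_trans.
    by rewrite /N /Rintegral fineK//; exact: integrable_fin_num.
Qed.

(** The substitution v |-> v h moves the right translation by h from the first
    factor to the second, which is right invariant under H. *)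
Lemma conv_hecke f (g : X -> R[i]) : hecke_algebra f -> hecke_algebra g ->
  hecke_algebra (conv nu f g).
Proof.
move=> hf hg; have ig := L2_cintegrable finX (continuous_L2 (hecke_continuous hg)).
split; first by apply: compactly_supported_coset; exact: conv_continuous.
move=> x h; have Hh : (H : set G) (val h) by exact: set_mem (valP h).
rewrite !convE /kernel_op.
rewrite -(@cintegral_coset_act (fun v => coset_kernel f (pi (x * val h)%g, v) * g v) (val h)).
  congr cintegral; apply/funext => v; rewrite -(rcoset_repr v) coset_act_rcoset.
  rewrite !hecke_kernelE// (hecke_right _ hg Hh) invgM.
  by congr (f (pi _) * _); rewrite mulgA mulgK.
apply: continuous_complexM; last exact: hecke_continuous.
exact: (continuous_slicer (coset_kernel_continuous hf)).
Qed.

(** The kernel of a convolution is the composition of the kernels; the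
    substitution is w |-> w y^-1, with v = Hy. *)
Lemma coset_kernel_conv f (g : X -> R[i]) (u v : X) :
  hecke_algebra f -> hecke_algebra g ->
  coset_kernel (conv nu f g) (u, v) =
  cintegral nu (fun w => coset_kernel f (u, w) * coset_kernel g (w, v)).
Proof.
move=> hf hg; rewrite -(rcoset_repr u) -(rcoset_repr v).
set x := repr u; set y := repr v.
rewrite hecke_kernelE; last exact: conv_hecke.
rewrite convE /kernel_op -(@cintegral_coset_act
  (fun w => coset_kernel f (pi (x * y^-1)%g, w) * g w) y^-1%g); last first.
  apply: continuous_complexM; last exact: hecke_continuous.
  exact: (continuous_slicer (coset_kernel_continuous hf)).
congr cintegral; apply/funext => w; rewrite -(rcoset_repr w) coset_act_rcoset.
rewrite !hecke_kernelE//; congr (f (pi _) * _).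
by rewrite invgM invgK mulgA mulgVK.
Qed.

Lemma conv_assoc f (g : X -> R[i]) xi :
  hecke_algebra f -> hecke_algebra g -> L2 nu xi ->
  conv nu (conv nu f g) xi = conv nu f (conv nu g xi).
Proof.
move=> hf hg /(L2_cintegrable finX) ix; apply/funext => u.
have cKf := coset_kernel_continuous hf; have cKg := coset_kernel_continuous hg.
pose K (z : X * X) := coset_kernel f (u, z.1) * coset_kernel g z.
have cK : continuous (K : X * X -> R[i]^o).
  apply: continuous_complexM cKg => z.
  apply: (@continuous_comp _ _ _ fst (fun w => coset_kernel f (u, w) : R[i]^o)).
    exact: cvg_fst.
  exact: (continuous_slicer cKf).
rewrite !convE /kernel_op.
transitivity (cintegral nu (fun v => cintegral nu (fun w => K (w, v)) * xi v)).
  by congr cintegral; apply/funext => v; rewrite coset_kernel_conv.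
rewrite -(cintegral_swap hX cX hX cX finX cK ix).
congr cintegral; apply/funext => w.
rewrite -cintegralZ; last exact: (kernel_cintegrable hX cX cKg).
by congr cintegral; apply/funext => v; rewrite /K mulrA.
Qed.

Lemma regular_representation_cocompact : regular_representation nu.
Proof.
split.
- move=> f hf; split; last exact: conv_bounded_operator.
  move=> xi /(L2_cintegrable finX) ix; apply: aeW => u.
  exact: (kernel_cintegrable hX cX (coset_kernel_continuous hf) u ix).
- move=> a f g xi hf hg /(L2_cintegrable finX) ix; apply: aeW => u.
  have kf := kernel_cintegrable hX cX (coset_kernel_continuous hf) u ix.
  have kg := kernel_cintegrable hX cX (coset_kernel_continuous hg) u ix.
  rewrite /conv -(cintegralZ a kf) -(cintegralD (cintegrableZ a kf) kg).
  by congr cintegral; apply/funext => v; rewrite /conv_kernel mulrDl -mulrA.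
- move=> f g hf hg; split; first exact: conv_hecke.
  by move=> xi L2x; apply: aeW => u; rewrite conv_assoc.
Qed.

Lemma hecke_algebra1 : hecke_algebra (fun _ : X => 1 : R[i]).
Proof.
split=> //; apply: compactly_supported_coset.
by apply/continuous_complexP; split; exact: cst_continuous.
Qed.

End regular_representation.

(** * Continuous functions with compact support *)

Section continuous_compact_support.
Variables (R : realType) (T : topologicalType).
Implicit Types (f g : T -> R).

Definition Cc f : Prop :=
  continuous f /\ exists2 K, compact K & forall x, ~ K x -> f x = 0.

Lemma Cc_mulr f g : Cc f -> continuous g -> Cc (fun x => f x * g x).
Proof.
move=> [cf [K cK fK]] cg; split; last by exists K => // x /fK ->; rewrite mul0r.
by move=> x; apply: cvgM; [exact: cf|exact: cg].
Qed.

Lemma Cc_mull f g : continuous f -> Cc g -> Cc (fun x => f x * g x).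
Proof.
move=> cf cg; rewrite (_ : (fun _ => _) = fun x => g x * f x).
  exact: Cc_mulr.
by apply/funext => x; rewrite mulrC.
Qed.

Lemma Cc_add f g : Cc f -> Cc g -> Cc (fun x => f x + g x).
Proof.
move=> [cf [K cK fK]] [cg [L cL gL]]; split.
  by move=> x; apply: cvgD; [exact: cf|exact: cg].
exists (K `|` L); first exact: compactU.
by move=> x /not_orP[/fK -> /gL ->]; rewrite addr0.
Qed.

End continuous_compact_support.

Lemma Cc_comp (R : realType) (T U : topologicalType) (f : U -> R) (p : T -> U)
  (q : U -> T) : continuous p -> continuous q -> cancel p q ->
  Cc f -> Cc (fun x => f (p x)).
Proof.
move=> cp cq pq [cf [K cK fK]]; split.
  by move=> x; apply: continuous_comp; [exact: cp|exact: cf].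
exists (q @` K).
  by apply: continuous_compact => //; exact: continuous_subspaceT.
by move=> x nqK; apply: fK => Kpx; apply: nqK; exists (p x) => //; rewrite pq.
Qed.

Section Cc_integral.
Variables (R : realType) (T : ptopologicalType).
Variable m : {measure set (borel T) -> \bar R}.
Hypotheses (hT : hausdorff_space T).
Hypothesis m_fin : forall K : set T, compact K -> (m K < +oo)%E.
Implicit Types (f g : T -> R).

Lemma Rintegral_eq0 (D : set (borel T)) f : (forall x, D x -> f x = 0) ->
  \int[m]_(x in D) f x = 0.
Proof.
move=> f0; rewrite (@eq_Rintegral _ _ _ m D (fun=> 0)) => [|x /set_mem]; last exact: f0.
by rewrite /Rintegral integral0.
Qed.

Lemma Rintegral_support f (K : set T) : compact K ->
  (forall x, ~ K x -> f x = 0) -> \int[m]_x f x = \int[m]_(x in K) f x.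
Proof.
move=> cK fK; rewrite [RHS]Rintegral_mkcond; apply: eq_Rintegral => x _.
by rewrite patchE; case: ifPn => //; rewrite notin_setE => /fK.
Qed.

Lemma Cc_integrable f : Cc f -> m.-integrable setT (EFin \o f).
Proof.
move=> [cf [K cK fK]].
have iK := continuous_integrable hT cK (m_fin cK) cf.
have mK : measurable (K : set (borel T)) by exact: compact_borel.
have := (integrable_mkcond _ mK).1 iK.
congr (integrable _ _ _); apply/funext => x.
by rewrite patchE; case: ifPn => //; rewrite notin_setE => /fK /= ->.
Qed.

End Cc_integral.

Section Cc_parametric.
Variables (R : realType) (T Y : ptopologicalType).
Variable n : {measure set (borel Y) -> \bar R}.
Hypotheses (hY : hausdorff_space Y).
Hypothesis n_fin : forall K : set Y, compact K -> (n K < +oo)%E.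

Let i1 (B : set Y) : compact B -> n.-integrable B (EFin \o (fun=> 1)).
Proof.
by move=> cB; apply: continuous_integrable (n_fin cB) _ => //; exact: cst_continuous.
Qed.

(** The support in y is only required to be compact locally uniformly in t,
    which is what translates of a function of compact support satisfy. *)
Lemma continuous_parametric (F : T * Y -> R) : continuous F ->
  (forall t0 : T, exists2 B : set Y, compact B &
    nbhs t0 [set t | forall y, ~ B y -> F (t, y) = 0]) ->
  continuous (fun t => \int[n]_y F (t, y)).
Proof.
move=> cF locF t0; have [B cB FB] := locF t0.
have cI := @continuous_kernel_integral R T Y n F B (fun=> 1) cF hY cB (i1 cB) t0.
have E t : (forall y, ~ B y -> F (t, y) = 0) ->
    \int[n]_(y in B) (F (t, y) * 1) = \int[n]_y F (t, y).
  move=> FBt; rewrite (Rintegral_support _ cB FBt).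
  by apply: eq_Rintegral => y _; rewrite mulr1.
rewrite /continuous_at -(E t0 (nbhs_singleton FB)).
apply: cvg_trans cI; apply: near_eq_cvg; apply: filterS FB => t.
exact: E.
Qed.

Variable m : {measure set (borel T) -> \bar R}.
Hypotheses (hT : hausdorff_space T).
Hypothesis m_fin : forall K : set T, compact K -> (m K < +oo)%E.

Lemma Cc_fubini (F : T * Y -> R) (A : set T) (B : set Y) :
  continuous F -> compact A -> compact B ->
  (forall x y, F (x, y) != 0 -> A x /\ B y) ->
  \int[m]_x (\int[n]_y F (x, y)) = \int[n]_y (\int[m]_x F (x, y)).
Proof.
move=> cF cA cB FAB.
have F0l x y : ~ A x -> F (x, y) = 0.
  by move=> nA; apply/eqP; apply: contrapT => /negP/FAB[].
have F0r x y : ~ B y -> F (x, y) = 0.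
  by move=> nB; apply/eqP; apply: contrapT => /negP/FAB[].
have iA : m.-integrable A (EFin \o (fun=> 1)).
  by apply: continuous_integrable (m_fin cA) _ => //; exact: cst_continuous.
transitivity (\int[m]_(x in A) (\int[n]_(y in B) (F (x, y) * 1) * 1)).
  rewrite (Rintegral_support _ cA); last first.
    by move=> x nA; rewrite (Rintegral_support _ cB) => [|y /F0r->//];
      apply: Rintegral_eq0 => y _; rewrite F0l.
  apply: eq_Rintegral => x _; rewrite mulr1 (Rintegral_support _ cB (F0r x)).
  by apply: eq_Rintegral => y _; rewrite mulr1.
rewrite (@fubini_weighted R T Y m n F A B (fun=> 1) cF hT hY cA cB (i1 cB) (fun=> 1) iA).
rewrite [RHS](Rintegral_support _ cB); last first.
  by move=> y nB; apply: Rintegral_eq0 => x _; rewrite F0r.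
apply: eq_Rintegral => y _; rewrite mulr1 (Rintegral_support _ cA (fun x => F0l x y)).
by apply: eq_Rintegral => x _; rewrite mulr1.
Qed.

End Cc_parametric.

(** * Haar measure *)

Section haar.
Variables (R : realType) (G : topologicalGroupType).
Variable mu : {measure set (borel G) -> \bar R}.
Hypotheses (hG : hausdorff_space G) (haar : right_haar mu).
Implicit Types (f g : G -> R).

Lemma haar_compact (K : set G) : compact K -> (mu K < +oo)%E.
Proof. by have [[h _ _] _ _] := haar; exact: h. Qed.

Lemma compact_mulg (K L : set G) : compact K -> compact L ->
  compact [set (x * y)%g | x in K & y in L].
Proof.
move=> cK cL.
rewrite (_ : [set _ | _ in _ & _ in _] = (fun z : G * G => (z.1 * z.2)%g) @` (K `*` L)).
  apply: continuous_compact; last exact: compact_setX.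
  by apply: continuous_subspaceT; exact: mulg_continuous.
apply/seteqP; split=> [_ [x Kx [y Ly <-]]|_ [[x y] [/= Kx Ly] <-]].
  by exists (x, y).
by exists x => //; exists y.
Qed.

Lemma compact_invg (K : set G) : compact K -> compact [set x^-1%g | x in K].
Proof.
move=> cK; apply: continuous_compact => //; apply: continuous_subspaceT.
exact: invg_continuous.
Qed.

Lemma haar_preimage_mulr (g : G) (A : set (borel G)) : measurable A ->
  mu ((fun x : G => (x * g)%g) @^-1` A) = mu A.
Proof.
have [_ inv _] := haar; move=> mA; rewrite -(inv g^-1%g A mA); congr (mu _).
apply/seteqP; split=> [x /= Ax|_ [x Ax <-] /=]; last by rewrite mulgVK.
by exists (x * g)%g => //; rewrite mulgK.
Qed.

Lemma haar_mulr f (g : G) : continuous f ->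
  \int[mu]_x f (x * g)%g = \int[mu]_x f x.
Proof.
move=> cf; apply: (@Rintegral_image R G G mu mu (fun x => (x * g)%g)).
- by apply: continuous_measurable; exact: continuous_mulr.
- exact: haar_preimage_mulr.
- exact: continuous_borel.
Qed.

Lemma haar_mull f (g : G) : left_invariant mu -> continuous f ->
  \int[mu]_x f (g * x)%g = \int[mu]_x f x.
Proof.
move=> inv cf.
apply: (@Rintegral_image R G G mu mu (fun x => (g * x)%g)).
- by apply: continuous_measurable; exact: continuous_mull.
- move=> A mA; rewrite -(inv g^-1%g A mA); congr (mu _).
  apply/seteqP; split=> [x /= Ax|_ [x Ax <-] /=]; last by rewrite mulVKg.
  by exists (g * x)%g => //; rewrite mulKg.
- exact: continuous_borel.
Qed.

(** If U were null, then so would be every compact set, which is covered by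
    finitely many translates of U; inner regularity would then make mu zero. *)
Lemma haar_open_gt0 (U : set G) x0 : open U -> U x0 -> (0 < mu U)%E.
Proof.
move=> oU Ux0; rewrite lt0e measure_ge0 andbT; apply/negP => /eqP U0.
have [[_ _ inner] inv T0] := haar; apply: T0.
rewrite (inner _ openT); apply/eqP; rewrite eq_le; apply/andP; split; last first.
  by apply: ereal_sup_ubound; exists set0; [split => //; exact: compact0|rewrite measure0].
apply: ge_ereal_sup => _ [K [cK _] <-].
pose V (k : G) := [set (x * (x0^-1 * k))%g | x in U].
have VE k : V k = [set x | U (x * (k^-1 * x0))%g].
  apply/seteqP; split=> [_ [x Ux <-] /=|x /= Ux].
    by rewrite -mulgA -(mulgA x0^-1%g) (mulgA k) mulgV mul1g mulVg mulg1.
  exists (x * (k^-1 * x0))%g => //.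
  by rewrite -mulgA -(mulgA k^-1%g) (mulgA x0) mulgV mul1g mulVg mulg1.
have V0 k : mu (V k) = 0 by rewrite inv// ?U0//; exact: open_borel.
have oV k : open (V k).
  rewrite VE; apply: (@open_comp _ _ (fun x => x * (k^-1 * x0))%g U) => // x _.
  exact: continuous_mulr.
have : cover_compact K by rewrite -compact_cover.
move=> /(_ G setT V)[|k _|D _ KD]; first by [].
  by exists k => //; rewrite VE /= mulgA mulgV mul1g.
have neg : mu.-negligible (\bigcup_(k in [set` D]) V k).
  rewrite bigcup_fset; apply: (big_ind (fun A => mu.-negligible A)).
  - exact: negligible_set0.
  - by move=> A B; exact: negligibleU.
  - by move=> k _; exists (V k); split=> //; exact: open_borel.
have [N [mN N0 VN]] := neg.
rewrite -N0; apply: le_measure; last exact: subset_trans KD VN.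
- by apply/mem_set; exact: compact_borel.
- exact/mem_set.
Qed.

Lemma haar_gt0 f x0 : Cc f -> (forall x, 0 <= f x) -> 0 < f x0 ->
  0 < \int[mu]_x f x.
Proof.
move=> Cf f0 fx0; have cf := Cf.1.
pose c := f x0 / 2; have c0 : 0 < c by rewrite divr_gt0.
pose U := [set x | c < f x].
have oU : open U.
  by move/continuousP: cf => /(_ [set r | c < r]); apply; exact: open_gt.
have Ux0 : U x0 by rewrite /U /= /c ltr_pdivrMr// ltr_pMr// ltr1n.
have mU : measurable (U : set (borel G)) by exact: open_borel.
have mf : measurable_fun setT (EFin \o f : borel G -> \bar R).
  by apply/measurable_EFinP; exact: continuous_borel.
have iF := Cc_integrable hG haar_compact Cf.
rewrite -lte_fin fineK; last exact: integrable_fin_num.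
apply: (@lt_le_trans _ _ (\int[mu]_(x in U) (f x)%:E)%E); last first.
  by apply: ge0_subset_integral => //= x _; rewrite lee_fin.
apply: (@lt_le_trans _ _ (\int[mu]_(x in U) c%:E)%E).
  by rewrite integral_cst// mule_gt0//; exact: haar_open_gt0 Ux0.
apply: ge0_le_integral => //.
- by move=> x _; rewrite lee_fin ltW.
- exact: measurable_funTS.
- by move=> x Ux; rewrite lee_fin ltW.
Qed.

Lemma Cc_mulgr f (g : G) : Cc f -> Cc (fun x => f (x * g)%g).
Proof.
apply: (Cc_comp (q := fun x => (x * g^-1)%g)).
- exact: continuous_mulr.
- exact: continuous_mulr.
- by move=> x; rewrite mulgK.
Qed.

Lemma Cc_mulgl f (g : G) : Cc f -> Cc (fun x => f (g * x)%g).
Proof.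
apply: (Cc_comp (q := fun x => (g^-1 * x)%g)).
- exact: continuous_mull.
- exact: continuous_mull.
- by move=> x; rewrite mulKg.
Qed.

Lemma Cc_invg f : Cc f -> Cc (fun x => f x^-1%g).
Proof.
apply: (Cc_comp (q := fun x => x^-1%g)).
- exact: invg_continuous.
- exact: invg_continuous.
- exact: invgK.
Qed.

End haar.

Lemma locally_compact_nbhs (T : topologicalType) (x : T) :
  locally_compact [set: T] -> exists2 U : set T, nbhs x U & compact U.
Proof.
move=> /(_ x I); rewrite withinET => -[U nU [cU _]].
by exists U.
Qed.

(** By complete regularity of locally compact Hausdorff spaces. *)
Lemma exists_bump (R : realType) (G : topologicalGroupType) :
  hausdorff_space G -> locally_compact [set: G] ->
  exists f : G -> R, [/\ Cc f, forall x, 0 <= f x & 0 < f 1%g].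
Proof.
move=> hG lcG; have [U nU cU] := locally_compact_nbhs (1%g : G) lcG.
have crG := @locally_compact_completely_regular G R lcG hG.
have nU1 : ~ (~` interior U) (1%g : G) by apply; exact: nU.
have /(@uniform_separatorP _ R)[f [cf f01 f0 f1]] :=
  crG 1%g (~` interior U) (open_closedC (@open_interior _ U)) nU1.
exists (fun x => 1 - f x); split.
- split; first by move=> x; apply: cvgB; [exact: cvg_cst|exact: cf].
  exists U => // x nUx; rewrite (_ : f x = 1) ?subrr//.
  by apply: f1; exists x => //= /interior_subset.
- move=> x; have /f01 : range f (f x) by exists x.
  by rewrite /= in_itv/= subr_ge0 => /andP[].
- by rewrite (_ : f 1%g = 0) ?subr0//; apply: f0; exists 1%g.
Qed.

Section haar_modular.
Variables (R : realType) (G : topologicalGroupType).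
Variable mu : {measure set (borel G) -> \bar R}.
Hypotheses (hG : hausdorff_space G) (lcG : locally_compact [set: G]).
Hypothesis (haar : right_haar mu).
Implicit Types (f g : G -> R).

Local Notation mu_fin := (haar_compact haar).

(** Substitute y x^-1 for y in the integral of g, exchange the integrals, then
    substitute x y for x.  The outcome compares mu with its image under
    inversion. *)
Lemma haar_inversion_formula f g : Cc f -> Cc g ->
  \int[mu]_x f x * \int[mu]_x g x =
  \int[mu]_x (g x^-1%g * \int[mu]_y f (x * y)%g).
Proof.
move=> Cf Cg; have [cf [K cK fK]] := Cf; have [cg [L cL gL]] := Cg.
have iF := Cc_integrable hG mu_fin Cf.
have iG := Cc_integrable hG mu_fin Cg.
have fst_c : continuous (fst : G * G -> G) by move=> z; exact: cvg_fst.
have snd_c : continuous (snd : G * G -> G) by move=> z; exact: cvg_snd.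
pose F1 (z : G * G) := f z.1 * g (z.2 * z.1^-1)%g.
have cF1 : continuous F1.
  move=> z; apply: cvgM.
    by apply: (@continuous_comp _ _ _ fst f); [exact: fst_c|exact: cf].
  apply: (@continuous_comp _ _ _ (fun z : G * G => (z.2 * z.1^-1)%g) g); last exact: cg.
  by apply: continuous_mulg => //; exact: continuous_invg.
pose F2 (z : G * G) := f (z.2 * z.1)%g * g z.2^-1%g.
have cF2 : continuous F2.
  move=> z; apply: cvgM.
    apply: (@continuous_comp _ _ _ (fun z : G * G => (z.2 * z.1)%g) f); last exact: cf.
    exact: continuous_mulg.
  apply: (@continuous_comp _ _ _ (fun z : G * G => z.2^-1%g) g); last exact: cg.
  exact: continuous_invg.
have suppf x : f x != 0 -> K x.
  by apply: contra_neqP => nK; exact: fK.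
have suppg x : g x != 0 -> L x.
  by apply: contra_neqP => nL; exact: gL.
pose LK := [set (x * y)%g | x in L & y in K].
have cLK : compact LK by exact: compact_mulg.
have cLV : compact [set x^-1%g | x in L] by exact: compact_invg.
transitivity (\int[mu]_x (\int[mu]_y F1 (x, y))).
  rewrite -RintegralZr//; apply: eq_Rintegral => x _.
  rewrite -(haar_mulr haar x^-1%g cg) -RintegralZl//.
  exact: (Cc_integrable hG mu_fin (Cc_mulgr _ Cg)).
rewrite (Cc_fubini hG mu_fin hG mu_fin cF1 cK cLK); last first.
  move=> x y; rewrite mulf_eq0 negb_or => /andP[/= /suppf Kx /suppg Lyx].
  split=> //; exists (y * x^-1)%g => //; exists x => //.
  by rewrite mulgVK.
transitivity (\int[mu]_y (\int[mu]_x F2 (y, x))).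
  apply: eq_Rintegral => y _.
  rewrite -(haar_mulr haar y (continuous_slicel cF1)).
  by apply: eq_Rintegral => x _; rewrite /F1 /F2 /= invgM mulgA mulgV mul1g.
rewrite (Cc_fubini hG mu_fin hG mu_fin cF2 cLK cLV); last first.
  move=> y x; rewrite mulf_eq0 negb_or => /andP[/= /suppf Kxy /suppg Lx].
  split; last by exists x^-1%g => //; rewrite invgK.
  exists x^-1%g => //; exists (x * y)%g => //; by rewrite mulgA mulVg mul1g.
apply: eq_Rintegral => x _; rewrite /F2 /= mulrC -RintegralZr//.
exact: (Cc_integrable hG mu_fin (Cc_mulgl _ Cf)).
Qed.

Lemma haar_left_translate_continuous f : Cc f ->
  continuous (fun x => \int[mu]_y f (x^-1 * y)%g).
Proof.
move=> [cf [K cK fK]].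
have cF : continuous (fun z : G * G => f (z.1^-1 * z.2)%g).
  move=> z.
  apply: (@continuous_comp _ _ _ (fun z : G * G => (z.1^-1 * z.2)%g) f); last exact: cf.
  apply: continuous_mulg; last by move=> ?; exact: cvg_snd.
  by apply: continuous_invg => ?; exact: cvg_fst.
apply: (continuous_parametric hG mu_fin cF) => x0.
have [N nN cN] := locally_compact_nbhs x0 lcG.
exists [set (x * y)%g | x in N & y in K]; first exact: compact_mulg.
apply: filterS nN => x Nx y nNK; apply: fK => Kxy; apply: nNK.
by exists x => //; exists (x^-1 * y)%g => //; rewrite mulgA mulgV mul1g.
Qed.

Lemma haar_right_translate_continuous f : Cc f ->
  continuous (fun x => \int[mu]_y f (x * y)%g).
Proof.
move=> Cf.
rewrite (_ : (fun _ => _) = (fun x => \int[mu]_y f (x^-1 * y)%g) \o (fun x => x^-1)%g).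
  move=> x; apply: continuous_comp; first exact: invg_continuous.
  exact: haar_left_translate_continuous.
by apply/funext => x /=; rewrite invgK.
Qed.

Lemma exists_bump_at x0 : exists f : G -> R,
  [/\ Cc f, forall x, 0 <= f x & 0 < f x0].
Proof.
have [b [Cb b0 b1]] := exists_bump R hG lcG.
exists (fun x => b (x * x0^-1)%g); split => //; first exact: Cc_mulgr.
by rewrite mulgV.
Qed.

(** Let E(x) be the difference of the two sides.  By the inversion formula,
    g(y^-1) E(y^-1) has integral 0 over y for every g of compact support.  With
    g := E b, where b is a bump at x, the integrand is nonnegative and
    continuous, so E(x) = 0. *)
Lemma haar_translate_ratio f1 f2 x : Cc f1 -> Cc f2 ->
  \int[mu]_y f1 (x^-1 * y)%g * \int[mu]_y f2 y =
  \int[mu]_y f2 (x^-1 * y)%g * \int[mu]_y f1 y.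
Proof.
move=> C1 C2; apply/eqP; rewrite -subr_eq0.
set I1 := \int[mu]_y f1 y; set I2 := \int[mu]_y f2 y.
pose E x := (\int[mu]_y f1 (x^-1 * y)%g) * I2 - (\int[mu]_y f2 (x^-1 * y)%g) * I1.
have cE : continuous E.
  by move=> y; apply: cvgB; apply: cvgMl; exact: haar_left_translate_continuous.
rewrite -/(E x); apply/negP => /negP Ex.
have [b [Cb b0 bx]] := exists_bump_at x.
have CEb : Cc (fun y => E y * E y * b y).
  by apply: Cc_mull => // y; apply: cvgM; exact: cE.
have CEb' : Cc (fun y => E y * b y) by exact: Cc_mull.
have h1 := haar_inversion_formula C1 CEb'.
have h2 := haar_inversion_formula C2 CEb'.
have CD f (c : R) : Cc f ->
    mu.-integrable setT (EFin \o
      (fun y => E y^-1%g * b y^-1%g * (\int[mu]_z f (y * z)%g) * c)).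
  move=> Cf; apply: (Cc_integrable hG mu_fin); apply: (Cc_mulr (g := fun=> c)); last first.
    exact: cst_continuous.
  apply: Cc_mulr.
    exact: (Cc_invg CEb').
  exact: haar_right_translate_continuous.
have : 0 < \int[mu]_y (E y^-1%g * E y^-1%g * b y^-1%g).
  apply: (haar_gt0 hG haar (x0 := x^-1%g) (Cc_invg CEb)).
    by move=> y; rewrite mulr_ge0// -expr2 sqr_ge0.
  by rewrite /= invgK mulr_gt0// -expr2 exprn_even_gt0.
rewrite (_ : Rintegral _ _ _ = 0) ?ltxx//.
transitivity (\int[mu]_y (E y^-1%g * b y^-1%g * (\int[mu]_z f1 (y * z)%g) * I2 -
    E y^-1%g * b y^-1%g * (\int[mu]_z f2 (y * z)%g) * I1)).
  by apply: eq_Rintegral => y _; rewrite /E invgK; ring.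
rewrite (RintegralB measurableT (CD _ I2 C1) (CD _ I1 C2)).
have CD1 f : Cc f -> mu.-integrable setT (EFin \o
    (fun y => E y^-1%g * b y^-1%g * (\int[mu]_z f (y * z)%g))).
  by move=> /(CD _ 1); congr (integrable _ _ _); apply/funext => y /=; rewrite mulr1.
rewrite (RintegralZr _ measurableT (CD1 _ C1)) (RintegralZr _ measurableT (CD1 _ C2)).
by rewrite -h1 -h2 -/I1 -/I2; ring.
Qed.

(** The ratio D(x) of the two integrals does not depend on f by
    [haar_translate_ratio].  D is the modular function of G. *)
Lemma haar_modular_function : exists D : G -> R,
  [/\ continuous D, forall x, 0 < D x, forall x y, D (x * y)%g = D x * D y &
    forall x f, Cc f -> \int[mu]_y f (x^-1 * y)%g = D x * \int[mu]_y f y].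
Proof.
have [b [Cb b0 b1]] := exists_bump R hG lcG.
set I := \int[mu]_y b y.
have I0 : 0 < I by exact: (haar_gt0 hG haar (x0 := 1%g)).
pose D x := (\int[mu]_y b (x^-1 * y)%g) / I.
have DE x f : Cc f -> \int[mu]_y f (x^-1 * y)%g = D x * \int[mu]_y f y.
  move=> Cf; rewrite /D mulrAC -haar_translate_ratio//.
  by rewrite mulfK// gt_eqF.
exists D; split => //.
- by move=> x; apply: cvgMl; exact: haar_left_translate_continuous.
- move=> x; rewrite divr_gt0//.
  apply: (haar_gt0 hG haar (x0 := x) (Cc_mulgl _ Cb)) => //.
  by rewrite /= mulVg.
- move=> x y; apply: (mulIf (lt0r_neq0 I0)).
  rewrite -DE// -mulrA -(DE y)// -DE; last exact: Cc_mulgl.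
  by apply: eq_Rintegral => z _; rewrite invgM mulgA.
Qed.

(** When mu is also left invariant, the inner integral in the inversion formula
    is constant. *)
Lemma haar_invg f : left_invariant mu -> Cc f ->
  \int[mu]_x f x^-1%g = \int[mu]_x f x.
Proof.
move=> linv Cf; have [b [Cb b0 b1]] := exists_bump R hG lcG.
have I0 : \int[mu]_y b y != 0.
  by rewrite gt_eqF//; exact: (haar_gt0 hG haar (x0 := 1%g)).
apply: (mulfI I0); rewrite (haar_inversion_formula Cb Cf) mulrC -RintegralZr//.
  by apply: eq_Rintegral => x _; rewrite (haar_mull _ linv Cb.1).
exact: (Cc_integrable hG mu_fin (Cc_invg Cf)).
Qed.

End haar_modular.

(** * Integration along the cosets of a closed subgroup *)

Section closed_subgroup.
Variables (G : topologicalGroupType) (H : subgroup G).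
Hypotheses (hG : hausdorff_space G) (closedH : closed (H : set G)).
Local Notation S := (subgroup_type H).

Lemma subgroup_val_continuous : continuous (val : S -> G).
Proof. exact: initial_continuous. Qed.

Lemma subgroup_valP (h : S) : (H : set G) (val h).
Proof. exact: set_mem (valP h). Qed.

Lemma subgroup_lift x : (H : set G) x -> exists h : S, val h = x.
Proof. by move=> /mem_set Hx; exists (exist _ x Hx : S). Qed.

Lemma nbhs_subgroup (h : S) (A : set S) : nbhs h A ->
  exists2 U : set G, nbhs (val h) U & val @^-1` U `<=` A.
Proof.
rewrite nbhsE => -[B [[U oU UB] Bh] BA]; exists U; last first.
  by move=> k Uk; apply: BA; rewrite -UB.
by apply: open_nbhs_nbhs; split => //; move: Bh; rewrite -UB.
Qed.

Lemma subgroup_hausdorff : hausdorff_space S.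
Proof.
move=> h k hk; apply: val_inj; apply: hG => U V nU nV.
have [l [Ul Vl]] := hk _ _ (subgroup_val_continuous nU) (subgroup_val_continuous nV).
by exists (val l).
Qed.

(** A closed subgroup is a closed subspace: a filter on the subgroup containing
    the trace of K clusters in G at a point of K, which is in H. *)
Lemma compact_subgroup (K : set G) : compact K -> compact (val @^-1` K : set S).
Proof.
move=> cK F PF FK.
have [x [Kx xF]] := cK (val @ F) _ FK.
have Hx : (H : set G) x.
  apply: closedH => U nU; have /xF/(_ nU)[y [Hy Uy]] : (val @ F) (H : set G).
    by apply: (@filterS _ F _ setT); [move=> h _; exact: subgroup_valP|exact: filterT].
  by exists y.
have [h hx] := subgroup_lift Hx.
exists h; split; first by rewrite /preimage /= hx.
move=> A B FA /nbhs_subgroup[U nU UB]; rewrite hx in nU.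
have FA' : (val @ F) ((val : S -> G) @` A).
  by apply: (@filterS _ F _ A) => // k Ak; exists k.
have [_ [[k Ak <-] Uk]] := xF _ _ FA' nU.
by exists k; split => //; exact: UB.
Qed.

Lemma subgroup_locally_compact :
  locally_compact [set: G] -> locally_compact [set: S].
Proof.
move=> lcG h _; rewrite withinET.
have [U nU cU] := locally_compact_nbhs (val h) lcG.
exists (val @^-1` U : set S); first exact: subgroup_val_continuous nU.
split; first exact: compact_subgroup.
by apply: compact_closed; [exact: subgroup_hausdorff|exact: compact_subgroup].
Qed.

End closed_subgroup.

Section fiber_integral.
Variables (R : realType) (G : topologicalGroupType) (H : subgroup G).
Local Notation S := (subgroup_type H).
Local Notation X := (coset_space H).
Local Notation pi := (rcoset H).
Variable eta : {measure set (borel S) -> \bar R}.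
Hypotheses (hG : hausdorff_space G) (lcG : locally_compact [set: G]).
Hypotheses (closedH : closed (H : set G)).
Hypotheses (haar_eta : right_haar eta).
Implicit Types (f phi : G -> R).

Let hS : hausdorff_space S. Proof. exact: subgroup_hausdorff. Qed.
Let lcS : locally_compact [set: S]. Proof. exact: subgroup_locally_compact. Qed.
Let eta_fin := haar_compact haar_eta.

Lemma fiber_Cc f x : Cc f -> Cc (fun h : S => f (val h * x)%g).
Proof.
move=> /(@Cc_mulgr _ _ f x)[cf [K cK fK]]; split.
  move=> h; apply: (@continuous_comp _ _ _ (val : S -> G) (fun y => f (y * x)%g)).
    exact: subgroup_val_continuous.
  exact: cf.
exists (val @^-1` K); first exact: compact_subgroup.
by move=> h; exact: fK.
Qed.

Definition fiber f x := \int[eta]_h f (val h * x)%g.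

Lemma fiber_mull f (k : S) x : Cc f -> fiber f (val k * x)%g = fiber f x.
Proof.
move=> /(fiber_Cc x)[cf _]; rewrite /fiber -[RHS](haar_mulr haar_eta k cf).
by apply: eq_Rintegral => h _; rewrite mulgA.
Qed.

Lemma fiber_coset f x y : Cc f -> pi x = pi y -> fiber f x = fiber f y.
Proof.
move=> Cf /rcoset_eqP/subgroup_lift[k kE].
by rewrite -(fiber_mull k y Cf) kE mulgVK.
Qed.

Lemma fiber_mulr f x (g : G) : fiber (fun y => f (y * g)%g) x = fiber f (x * g)%g.
Proof. by apply: eq_Rintegral => h _; rewrite mulgA. Qed.

Lemma fiber_kernel_continuous f : continuous f ->
  continuous (fun z : G * S => f (val z.2 * z.1)%g).
Proof.
move=> cf z; apply: (@continuous_comp _ _ _ (fun z : G * S => (val z.2 * z.1)%g) f).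
  apply: continuous_mulg; last by move=> ?; exact: cvg_fst.
  move=> w; apply: (@continuous_comp _ _ _ (snd : G * S -> S) (val : S -> G)); first exact: cvg_snd.
  exact: subgroup_val_continuous.
exact: cf.
Qed.

Lemma fiber_continuous f : Cc f -> continuous (fiber f).
Proof.
move=> [cf [K cK fK]].
apply: (continuous_parametric hS eta_fin (fiber_kernel_continuous cf)) => x0.
have [N nN cN] := locally_compact_nbhs x0 lcG.
exists (val @^-1` [set (y * z)%g | y in K & z in [set x^-1%g | x in N]] : set S).
  by apply: compact_subgroup => //; apply: compact_mulg => //; exact: compact_invg.
apply: filterS nN => x Nx h nKN; apply: fK => Khx; apply: nKN.
exists (val h * x)%g => //; exists x^-1%g; first by exists x.
by rewrite mulgK.
Qed.

Lemma fiber_gt0 f (h : S) x : Cc f -> (forall y, 0 <= f y) -> 0 < f (val h * x)%g ->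
  0 < fiber f x.
Proof. by move=> Cf f0 fx; apply: (haar_gt0 hS haar_eta (fiber_Cc x Cf) _ fx). Qed.

(** A function invariant under H on the left is constant along the fibers. *)
Lemma fiberMr f (c : G -> R) x : Cc f -> (forall (h : S) y, c (val h * y)%g = c y) ->
  fiber (fun y => f y * c y) x = fiber f x * c x.
Proof.
move=> Cf cH; rewrite /fiber -RintegralZr//.
  by apply: eq_Rintegral => h _; rewrite cH.
exact: (Cc_integrable hS eta_fin (fiber_Cc x Cf)).
Qed.

(** Finitely many translates of a bump are together positive on a set meeting
    every coset; their sum f is then divided by its fiber integral, which is
    positive, continuous and constant along the cosets. *)
Lemma exists_cutoff : compact [set: X] ->
  exists phi : G -> R, [/\ Cc phi, forall x, 0 <= phi x & forall x, fiber phi x = 1].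
Proof.
move=> cX.
have [b [Cb b0 b1]] := exists_bump R hG lcG.
pose b_ (g : G) x := b (x * g^-1)%g.
have Cb_ (g : G) : Cc (b_ g) by exact: Cc_mulgr.
pose U (g : G) : set X := pi @` [set x | 0 < b_ g x].
have : cover_compact [set: X] by rewrite -compact_cover.
move=> /(_ G setT U)[g _|u _|D _ XD].
- apply: rcoset_open; have /continuousP := (Cb_ g).1.
  by move=> /(_ [set r | 0 < r]); apply; exact: open_gt.
- by exists (repr u) => //; exists (repr u); rewrite ?rcoset_repr//= /b_ mulgV.
pose f x := \sum_(g <- D) b_ g x.
have Cf : Cc f.
  rewrite /f; elim: (enum_fset D) => [|g s ih].
    rewrite (_ : (fun _ => _) = fun=> 0).
      by split; [exact: cst_continuous|exists set0 => //; exact: compact0].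
    by apply/funext => x; rewrite big_nil.
  rewrite (_ : (fun _ => _) = fun x => b_ g x + \sum_(k <- s) b_ k x).
    exact: Cc_add.
  by apply/funext => x; rewrite big_cons.
have f0 x : 0 <= f x by apply: sumr_ge0 => g _; exact: b0.
have fibf x : 0 < fiber f x.
  have [g /= gD [y /= bgy /rcoset_eqP/subgroup_lift[h hE]]] := XD (pi x) I.
  apply: (fiber_gt0 (h := h)) => //; rewrite hE mulgVK.
  rewrite /f (big_rem g)//=; apply: ltr_pwDl => //.
  by apply: sumr_ge0 => k _; exact: b0.
have cfib := fiber_continuous Cf.
exists (fun x => f x * (fiber f x)^-1); split.
- apply: Cc_mulr => // x; apply: cvgV; [by rewrite gt_eqF|exact: cfib].
- by move=> x; rewrite mulr_ge0// invr_ge0 ltW.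
- move=> x; rewrite (fiberMr _ Cf) ?mulfV ?gt_eqF//.
  by move=> h y; rewrite fiber_mull.
Qed.

End fiber_integral.

(** * Unimodularity *)

Section weil.
Variables (R : realType) (G : topologicalGroupType) (H : subgroup G).
Local Notation S := (subgroup_type H).
Local Notation X := (coset_space H).
Local Notation pi := (rcoset H).
Variable mu : {measure set (borel G) -> \bar R}.
Variable eta : {measure set (borel S) -> \bar R}.
Hypotheses (hG : hausdorff_space G) (lcG : locally_compact [set: G]).
Hypotheses (closedH : closed (H : set G)).
Hypotheses (haar_mu : right_haar mu) (haar_eta : right_haar eta).
Hypotheses (left_eta : left_invariant eta).
Implicit Types (f phi : G -> R).

Let hS : hausdorff_space S. Proof. exact: subgroup_hausdorff. Qed.
Let lcS : locally_compact [set: S]. Proof. exact: subgroup_locally_compact. Qed.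
Let eta_fin := haar_compact haar_eta.
Let mu_fin := haar_compact haar_mu.
Local Notation fiber := (fiber eta).

(** The substitution x |-> h^-1 x brings out the factor D(h^-1), which the
    hypothesis on c absorbs.  The inverse on h is then removed by the invariance
    of eta under inversion. *)
Lemma fiber_swap phi1 phi2 (c D : G -> R) : Cc phi1 -> Cc phi2 -> continuous c ->
  (forall x f, Cc f -> \int[mu]_y f (x^-1 * y)%g = D x * \int[mu]_y f y) ->
  (forall (h : S) x, D ((val h)^-1)%g * c ((val h)^-1 * x)%g = c x) ->
  \int[mu]_x (phi1 x * c x * fiber phi2 x) = \int[mu]_x (fiber phi1 x * c x * phi2 x).
Proof.
move=> C1 C2 cc DE cD.
have [c1 [K1 cK1 phi1K]] := C1; have [c2 [K2 cK2 phi2K]] := C2.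
have supp1 x : phi1 x != 0 -> K1 x by apply: contra_neqP => nK; exact: phi1K.
have supp2 x : phi2 x != 0 -> K2 x by apply: contra_neqP => nK; exact: phi2K.
pose F1 (z : G * S) := phi1 z.1 * c z.1 * phi2 (val z.2 * z.1)%g.
have cfst (T Y Z : topologicalType) (g : T -> Z) : continuous g ->
    continuous (fun z : T * Y => g z.1).
  by move=> cg z; apply: (@continuous_comp _ _ _ fst g); [exact: cvg_fst|exact: cg].
have csnd (T Y Z : topologicalType) (g : Y -> Z) : continuous g ->
    continuous (fun z : T * Y => g z.2).
  by move=> cg z; apply: (@continuous_comp _ _ _ snd g); [exact: cvg_snd|exact: cg].
have cF1 : continuous F1.
  move=> z; apply: cvgM; last exact: fiber_kernel_continuous.
  by apply: cvgM; [exact: (cfst _ _ _ _ c1)|exact: (cfst _ _ _ _ cc)].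
pose F2 (z : S * G) := phi1 ((val z.1)^-1 * z.2)%g * c z.2 * phi2 z.2.
have cval1 : continuous (fun z : S * G => ((val z.1)^-1 * z.2)%g).
  apply: continuous_mulg; last by move=> ?; exact: cvg_snd.
  by apply: continuous_invg; apply: (cfst _ _ _ (val : S -> G));
    exact: subgroup_val_continuous.
have cF2 : continuous F2.
  move=> z; apply: cvgM; last exact: (csnd _ _ _ _ c2).
  apply: cvgM; last exact: (csnd _ _ _ _ cc).
  by apply: (@continuous_comp _ _ _ (fun z : S * G => ((val z.1)^-1 * z.2)%g) phi1);
    [exact: cval1|exact: c1].
pose B : set S := val @^-1` [set (y * z)%g | y in K2 & z in [set x^-1%g | x in K1]].
have cB : compact B.
  by apply: compact_subgroup => //; apply: compact_mulg => //; exact: compact_invg.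
transitivity (\int[mu]_x (\int[eta]_h F1 (x, h))).
  apply: eq_Rintegral => x _; rewrite -RintegralZl//.
  exact: (Cc_integrable hS eta_fin (fiber_Cc closedH x C2)).
rewrite (Cc_fubini hS eta_fin hG mu_fin cF1 cK1 cB); last first.
  move=> x h; rewrite !mulf_eq0 !negb_or => /andP[/andP[/= /supp1 Kx _] /supp2 Khx].
  split=> //; exists (val h * x)%g => //; exists x^-1%g; first by exists x.
  by rewrite mulgK.
transitivity (\int[eta]_h (\int[mu]_x F2 (h, x))).
  apply: eq_Rintegral => h _.
  pose Fh x := phi1 ((val h)^-1 * x)%g * c ((val h)^-1 * x)%g * phi2 x.
  have CFh : Cc Fh.
    apply: Cc_mull => // x; apply: (@continuous_comp _ _ _
      (fun x => (val h)^-1 * x)%g (fun x => phi1 x * c x)).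
      exact: continuous_mull.
    by apply: cvgM; [exact: c1|exact: cc].
  transitivity (\int[mu]_x Fh (((val h)^-1)^-1 * x)%g).
    by apply: eq_Rintegral => x _; rewrite /Fh /F1 /= invgK !mulKg.
  rewrite DE// -RintegralZl//; last exact: (Cc_integrable hG mu_fin).
  apply: eq_Rintegral => x _; rewrite /Fh /F2 /=.
  by rewrite -(cD h x); ring.
rewrite (Cc_fubini hG mu_fin hS eta_fin cF2 (B := K2)
  (A := [set h^-1%g | h in (val @^-1` [set (y * z)%g | y in K1 & z in [set x^-1%g | x in K2]] : set S)])) //; last 2 first.
- apply: compact_invg; apply: compact_subgroup => //.
  by apply: compact_mulg => //; exact: compact_invg.
- move=> h x; rewrite !mulf_eq0 !negb_or => /andP[/andP[/= /supp1 Khx _] /supp2 Kx].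
  split=> //; exists h^-1%g; last by rewrite invgK.
  exists ((val h)^-1 * x)%g => //.
  by exists x^-1%g; [exists x|rewrite mulgK].
apply: eq_Rintegral => x _.
have Cx := fiber_Cc closedH x C1.
have Ix := Cc_integrable hS eta_fin (Cc_invg Cx).
transitivity (\int[eta]_h (phi1 (val (h^-1)%g * x)%g * (c x * phi2 x))).
  by apply: eq_Rintegral => h _; rewrite /F2 mulrA.
rewrite (RintegralZr _ measurableT Ix) (haar_invg hS lcS haar_eta left_eta Cx).
by rewrite mulrA.
Qed.

Hypothesis cX : compact [set: X].

(** Apply [fiber_swap] with c := 1/D to a cutoff function phi and to its
    translate by g^-1: both have fiber integral 1, so the integrals of phi/D and
    of its translate are equal, while right invariance gives their ratio
    D(g)^-1. *)
Lemma haar_unimodular f x : Cc f -> \int[mu]_y f (x^-1 * y)%g = \int[mu]_y f y.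
Proof.
have [D [cD D0 DM DE]] := haar_modular_function hG lcG haar_mu.
suff D1 g : D g = 1 by move=> Cf; rewrite DE// D1 mul1r.
have [phi [Cphi phi0 fphi]] := exists_cutoff hG lcG closedH haar_eta cX.
pose c y := (D y)^-1.
have cc : continuous c by move=> y; apply: cvgV; [rewrite gt_eqF|exact: cD].
have cE (h : S) y : D ((val h)^-1)%g * c ((val h)^-1 * y)%g = c y.
  by rewrite /c DM invfM mulrA mulfV ?mul1r// gt_eqF.
have Cphig : Cc (fun y => phi (y * g^-1)%g) by exact: Cc_mulgr.
have := fiber_swap Cphi Cphig cc DE cE.
under eq_Rintegral do rewrite fiber_mulr fphi mulr1.
under [in RHS]eq_Rintegral do rewrite fphi mul1r.
have Cc1 : Cc (fun y => phi y * c y) by exact: Cc_mulr.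
have I0 : 0 < \int[mu]_y (phi y * c y).
  have [y y0] : exists y, 0 < phi y.
    apply: contrapT => /forallNP nphi; have := fphi 1%g.
    rewrite [X in X = _](@Rintegral_eq0 R _ eta) => [/eqP|h _].
      by rewrite eq_sym oner_eq0.
    by apply/eqP; rewrite eq_le phi0 andbT leNgt; apply/negP; exact: nphi.
  apply: (haar_gt0 hG haar_mu (x0 := y)) => //.
    by move=> z; rewrite mulr_ge0// invr_ge0 ltW.
  by rewrite mulr_gt0// invr_gt0.
have -> : \int[mu]_y (c y * phi (y * g^-1)%g) = (D g)^-1 * \int[mu]_y (phi y * c y).
  rewrite -RintegralZl//; last exact: (Cc_integrable hG mu_fin).
  rewrite -[LHS](haar_mulr haar_mu g); last first.
    by move=> y; apply: cvgM; [exact: cc|exact: Cphig.1].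
  by apply: eq_Rintegral => y _; rewrite mulgK /c DM invfM; ring.
move/(congr1 (fun r => r / \int[mu]_y (phi y * c y))).
rewrite mulfK ?mulfV ?gt_eqF// => /esym/(congr1 GRing.inv).
by rewrite invrK invr1.
Qed.

Lemma fiber_swap1 phi1 phi2 (c : G -> R) : Cc phi1 -> Cc phi2 -> continuous c ->
  (forall (h : S) x, c (val h * x)%g = c x) ->
  \int[mu]_x (phi1 x * c x * fiber phi2 x) = \int[mu]_x (fiber phi1 x * c x * phi2 x).
Proof.
move=> C1 C2 cc cH; apply: (fiber_swap (D := fun=> 1)) => //.
  by move=> x f Cf; rewrite mul1r haar_unimodular.
by move=> h x; rewrite mul1r; exact: (cH h^-1%g x).
Qed.

End weil.

(** * Images of measures with a density *)

Section density.
Context d d' (T : measurableType d) (T' : measurableType d') (R : realType).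
Variables (theta : T -> T') (mtheta : measurable_fun setT theta).
Variables (mu : {measure set T -> \bar R}) (phi : T -> R).
Hypotheses (mphi : measurable_fun setT phi) (phi0 : forall x, 0 <= phi x).

Let preimage_measurable (A : set T') : measurable A -> measurable (theta @^-1` A).
Proof. by move=> mA; rewrite -(setTI (_ @^-1` _)); exact: mtheta. Qed.

Let nu0 (A : set T') : \bar R := (\int[mu]_(x in theta @^-1` A) (phi x)%:E)%E.

Let nu0_0 : nu0 set0 = 0%E.
Proof. by rewrite /nu0 preimage_set0 integral_set0. Qed.

Let nu0_ge0 A : (0 <= nu0 A)%E.
Proof. by apply: integral_ge0 => x _; rewrite lee_fin. Qed.

Let nu0_sigma_additive : semi_sigma_additive nu0.
Proof.
move=> F mF tF mUF; rewrite /nu0 preimage_bigcup ge0_integral_bigcup//.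
- apply: is_cvg_ereal_nneg_natsum_cond => n _ _; exact: nu0_ge0.
- by move=> k; exact: preimage_measurable.
- by apply/measurable_EFinP; exact: measurable_funTS.
- by move=> x _; rewrite lee_fin.
- apply/trivIsetP => i j _ _ ij; rewrite -preimage_setI.
  by move/trivIsetP : tF => /(_ _ _ _ _ ij) ->//; rewrite preimage_set0.
Qed.

Lemma exists_density_measure : exists nu : {measure set T' -> \bar R},
  forall A, nu A = (\int[mu]_(x in theta @^-1` A) (phi x)%:E)%E.
Proof.
pose mx := isMeasure.Build _ _ _ nu0 nu0_0 nu0_ge0 nu0_sigma_additive.
by exists (HB.pack_for {measure set T' -> \bar R} nu0 mx).
Qed.

Variable nu : {measure set T' -> \bar R}.
Hypothesis nuE : forall A, measurable A ->
  nu A = (\int[mu]_(x in theta @^-1` A) (phi x)%:E)%E.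

Import HBNNSimple.

(** By monotone approximation of f by simple functions. *)
Lemma ge0_integral_density (f : T' -> \bar R) : measurable_fun setT f ->
  (forall y, 0 <= f y)%E ->
  (\int[nu]_y f y = \int[mu]_x (f (theta x) * (phi x)%:E))%E.
Proof.
move=> mf f0; pose f_ := nnsfun_approx measurableT mf.
have f_cvg y : (EFin \o f_^~ y) @ \oo --> f y by exact: cvg_nnsfun_approx.
transitivity (limn (fun n => \int[nu]_x (f_ n x)%:E)%E).
  rewrite -monotone_convergence//.
  - by apply: eq_integral => y _; apply/esym/cvg_lim => //; exact: f_cvg.
  - by move=> n; exact/measurable_EFinP.
  - by move=> n y _; rewrite lee_fin.
  - by move=> y _ m n mn; rewrite lee_fin; exact/lefP/nd_nnsfun_approx.
transitivity (limn (fun n => \int[mu]_x ((f_ n (theta x))%:E * (phi x)%:E))%E).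
  congr (limn _); apply/funext => n.
  rewrite integralT_nnsfun sintegralE.
  have mfn r : measurable (f_ n @^-1` [set r]) by exact: measurable_sfunP.
  transitivity (\sum_(k \in range (f_ n))
      \int[mu]_x (k * \1_(f_ n @^-1` [set k]) (theta x) * phi x)%:E)%E.
    apply: eq_fsbigr => r /set_mem[y _ ry].
    have r0 : 0 <= r by rewrite -ry.
    under eq_integral do rewrite -mulrA EFinM.
    rewrite ge0_integralZl//; last 2 first.
    - apply/measurable_EFinP; apply: measurable_funM => //.
      exact: (measurableT_comp (measurable_indic (mfn r)) mtheta).
    - by move=> x _; rewrite lee_fin mulr_ge0// indicE.
    congr (_ * _)%E; rewrite nuE// integral_mkcond; apply: eq_integral => x _.
    rewrite patchE indicE /=.
    rewrite (_ : (x \in _) = (theta x \in f_ n @^-1` [set r])).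
      by case: (theta x \in _); rewrite ?mul1r ?mul0r.
    by apply/idP/idP => /set_mem h; exact/mem_set.
  rewrite -ge0_integral_fsum//.
  - apply: eq_integral => x _; rewrite fsumEFin// -EFinM [in RHS]fimfunE.
    by rewrite !fsbig_finite//= mulr_suml.
  - move=> r; apply/measurable_EFinP; apply: measurable_funM => //.
    apply: measurable_funM => //.
    exact: (measurableT_comp (measurable_indic (mfn r)) mtheta).
  - move=> r x _; rewrite EFinM mule_ge0 ?lee_fin//.
    by have := nnfun_muleindic_ge0 (f_ n) r (theta x); rewrite -EFinM lee_fin.
rewrite -monotone_convergence//.
- apply: eq_integral => x _; apply/cvg_lim => //.
  by apply: cvgeZr => //; exact: f_cvg.
- move=> n; rewrite (_ : (fun _ => _) = EFin \o (fun x => f_ n (theta x) * phi x)).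
    apply/measurable_EFinP; apply: measurable_funM => //.
    by apply: (measurableT_comp _ mtheta).
  by apply/funext => x /=; rewrite EFinM.
- by move=> n x _; rewrite mule_ge0// lee_fin.
- move=> x _ m n mn; rewrite lee_wpmul2r ?lee_fin//.
  exact/lefP/nd_nnsfun_approx.
Qed.

End density.

(** * Radon measures on a compact space *)

Lemma measurable_indic_EFin (R : realType) d (T : measurableType d) (A : set T) :
  measurable A -> measurable_fun setT (fun x : T => (\1_A x)%:E : \bar R).
Proof. by move=> mA; exact/measurable_EFinP/measurable_indic. Qed.

Lemma continuous_norm_parts (R : realType) (T : topologicalType) (f : T -> R) :
  continuous f ->
  continuous (fun x => `|f x|) /\ continuous (fun x => `|f x| - f x).
Proof.
move=> cf; have cabs : continuous (fun x => `|f x|).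
  by move=> x; apply: cvg_norm; exact: cf.
by split=> // x; apply: cvgB; [exact: cabs|exact: cf].
Qed.

Section regularity.
Variables (R : realType) (X : ptopologicalType).
Hypotheses (hX : hausdorff_space X) (cX : compact [set: X]).
Implicit Types nu : {measure set (borel X) -> \bar R}.

(** For a finite measure, outer regularity of A is inner regularity of its
    complement. *)
Lemma radon_of_inner nu : (nu setT < +oo)%E ->
  (forall (A : set (borel X)) (e : R), measurable A -> 0 < e ->
    exists C : set X, [/\ compact C, C `<=` A & (nu (A `\` C) <= e%:E)%E]) ->
  radon nu.
Proof.
move=> nuT inner.
have split_le (A C : set (borel X)) : measurable A -> measurable C ->
    C `<=` A -> nu A = (nu C + nu (A `\` C))%E.
  move=> mA mC CA; rewrite -measureU//; last by rewrite setDIK.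
    by rewrite setDUK.
  exact: measurableD.
split.
- move=> K cK; apply: le_lt_trans nuT; apply: measure_mono => //.
  by apply: closed_borel; exact: compact_closed.
- move=> A mA; apply/eqP; rewrite eq_le; apply/andP; split.
    apply: le_ereal_inf_tmp => _ [U [oU AU] <-].
    by apply: measure_mono => //; exact: open_borel.
  apply/lee_addgt0Pr => e e0.
  have [C [cC CA nuC]] := inner _ _ (measurableC mA) e0.
  have clC : closed C by exact: compact_closed.
  apply: (@le_trans _ _ (nu (~` C))).
    apply: ereal_inf_lbound; exists (~` C) => //; split; first exact: closed_openC.
    by move=> x Ax /CA.
  have mC : measurable (~` C : set (borel X)) by apply: measurableC; exact: closed_borel.
  rewrite (split_le (~` C) A) => [||//|x Ax /CA//] //.
  apply: leeD => //; apply: le_trans nuC.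
  by rewrite le_eqVlt; apply/orP; left; apply/eqP; congr (nu _); rewrite setDE setIC.
- move=> U oU; have mU := open_borel oU.
  apply/eqP; rewrite eq_le; apply/andP; split; last first.
    apply: ge_ereal_sup => _ [K [cK KU] <-].
    by apply: measure_mono => //; exact: compact_borel.
  apply/lee_addgt0Pr => e e0.
  have [C [cC CU nuC]] := inner _ _ mU e0.
  rewrite (split_le U C)//; last exact: compact_borel.
  by apply: leeD => //; apply: ereal_sup_ubound; exists C.
Qed.

(** By Urysohn's lemma, a compact set C contained in an open set U is separated
    from the complement of U by a continuous function, which gives
    nu1 C <= nu2 U. *)
Lemma radon_eq nu1 nu2 : radon nu1 -> radon nu2 ->
  (forall f : X -> R, continuous f -> (forall x, 0 <= f x) ->
    (\int[nu1]_x (f x)%:E = \int[nu2]_x (f x)%:E)%E) ->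
  forall A : set (borel X), measurable A -> nu1 A = nu2 A.
Proof.
have open_le m1 m2 : radon m1 -> radon m2 ->
  (forall f : X -> R, continuous f -> (forall x, 0 <= f x) ->
    (\int[m1]_x (f x)%:E = \int[m2]_x (f x)%:E)%E) ->
    forall U : set X, open U -> (m1 U <= m2 U)%E.
  move=> [_ _ in1] r2 fE U oU; rewrite in1//; apply: ge_ereal_sup => _ [C [cC CU] <-].
  have clC : closed C by exact: compact_closed.
  have clU : closed (~` U) by exact: open_closedC.
  have UC : ~` U `&` C = set0.
    by apply/seteqP; split=> // x [nUx /CU].
  have [f [cf fU fC f01]] := @urysohn_ext_itv X R (compact_normal hX cX) _ _ 0 1
    clU clC UC ltr01.
  have f0 x : 0 <= f x.
    have /f01 : range f (f x) by exists x.
    by rewrite /= in_itv/= => /andP[].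
  have f1 x : f x <= 1.
    have /f01 : range f (f x) by exists x.
    by rewrite /= in_itv/= => /andP[].
  have mf : measurable_fun setT (EFin \o f : borel X -> \bar R).
    by apply/measurable_EFinP; exact: continuous_borel.
  have mC := closed_borel clC; have mU := open_borel oU.
  have -> : m1 C = (\int[m1]_x (\1_C x)%:E)%E by rewrite integral_indic// setIT.
  apply: (@le_trans _ _ (\int[m1]_x (f x)%:E)%E).
    apply: ge0_le_integral => //.
    - exact: measurable_indic_EFin.
    - move=> x _; rewrite lee_fin indicE; case: (boolP (x \in C)) => [/set_mem Cx|_].
        by rewrite (fC (f x))//; exists x.
      exact: f0.
  rewrite fE//.
  have -> : m2 U = (\int[m2]_x (\1_U x)%:E)%E by rewrite integral_indic// setIT.
  apply: ge0_le_integral => //.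
  - by move=> x _; rewrite lee_fin.
  - exact: measurable_indic_EFin.
  - move=> x _; rewrite lee_fin indicE; case: (boolP (x \in U)) => [_|/negP nUx].
      exact: f1.
    by rewrite (fU (f x))//; exists x => // Ux; apply: nUx; exact/mem_set.
move=> r1 r2 fE A mA; have [_ o1 _] := r1; have [_ o2 _] := r2.
rewrite o1// o2//; congr ereal_inf; apply/seteqP; split=> _ [U [oU AU] <-];
  exists U => //; apply/eqP; rewrite eq_le !open_le//.
- by move=> f cf f0; rewrite fE.
- by move=> f cf f0; rewrite fE.
Qed.

End regularity.

(** * The Weil measure *)

Section weil_measure.
Variables (R : realType) (G : topologicalGroupType) (H : subgroup G).
Local Notation S := (subgroup_type H).
Local Notation X := (coset_space H).
Local Notation pi := (rcoset H).
Variable mu : {measure set (borel G) -> \bar R}.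
Variable eta : {measure set (borel S) -> \bar R}.
Hypotheses (hG : hausdorff_space G) (lcG : locally_compact [set: G]).
Hypotheses (closedH : closed (H : set G)).
Hypotheses (haar_mu : right_haar mu) (haar_eta : right_haar eta).
Hypotheses (left_eta : left_invariant eta).
Hypotheses (cX : compact [set: X]).
Implicit Types (f phi : G -> R) (nu : {measure set (borel X) -> \bar R}).

Let hX : hausdorff_space X. Proof. exact: coset_space_hausdorff. Qed.
Let mu_fin := haar_compact haar_mu.
Let mpi : measurable_fun setT (pi : borel G -> borel X).
Proof. by apply: continuous_measurable; exact: rcoset_continuous. Qed.

Definition density nu phi := forall A : set (borel X), measurable A ->
  nu A = (\int[mu]_(x in pi @^-1` A) (phi x)%:E)%E.

Lemma exists_density phi : continuous phi -> (forall x, 0 <= phi x) ->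
  exists nu, density nu phi.
Proof.
move=> cphi phi0.
have [nu nuE] := @exists_density_measure _ _ (borel G) (borel X) R pi mpi mu phi
  (continuous_borel cphi) phi0.
by exists nu => A _; exact: nuE.
Qed.

Let mpreimage (A : set (borel X)) : measurable A ->
  measurable (pi @^-1` A : set (borel G)).
Proof. by move=> mA; rewrite -(setTI (_ @^-1` _)); exact: mpi. Qed.

Lemma density_finite nu phi : Cc phi -> density nu phi -> (nu setT < +oo)%E.
Proof.
move=> Cphi nuE; rewrite nuE// preimage_setT; apply: integrable_lty => //.
exact: (Cc_integrable hG mu_fin Cphi).
Qed.

(** With K the support of phi and B the trace on K of the preimage of A, outer
    regularity of mu on K \ B provides an open V containing K \ B such that the
    compact set K \ V exhausts B up to a small set.  The image of K \ V in the
    space of cosets is compact and exhausts A. *)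
Lemma density_radon nu phi : Cc phi -> (forall x, 0 <= phi x) ->
  density nu phi -> radon nu.
Proof.
move=> Cphi phi0 nuE; apply: radon_of_inner => //; first exact: density_finite nuE.
move=> A e mA e0; have [cphi [K cK phiK]] := Cphi.
have mK : measurable (K : set (borel G)) by exact: compact_borel.
have [M M0 phiM] : exists2 M : R, 0 <= M & forall x, K x -> phi x <= M.
  have [M [_ MP]] : bounded_set (phi @` K).
    by apply: compact_bounded; apply: continuous_compact => //; exact: continuous_subspaceT.
  exists (`|M| + 1) => [|x Kx]; first by rewrite addr_ge0.
  rewrite (le_trans (ler_norm _))//; apply: (MP (`|M| + 1)); last by exists x.
  by rewrite (le_lt_trans (ler_norm M))// ltrDl.
have d0 : 0 < e / (M + 1) by rewrite divr_gt0// ltr_wpDl.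
set B : set (borel G) := pi @^-1` A `&` K.
have mB : measurable B by apply: measurableI => //; exact: mpreimage.
have mKB : measurable (K `\` B : set (borel G)) by exact: measurableD.
have KBfin : (mu (K `\` B) < +oo)%E.
  by apply: le_lt_trans (mu_fin cK); apply: measure_mono.
have [V [oV KBV Vlt]] : exists V : set G, [/\ open V, K `\` B `<=` V &
    (mu V <= mu (K `\` B) + (e / (M + 1))%:E)%E].
  have [[_ outer _] _ _] := haar_mu.
  have KBnum : mu (K `\` B) \is a fin_num by rewrite ge0_fin_numE.
  have := KBnum; rewrite {1}(outer _ mKB) => /(lb_ereal_inf_adherent d0).
  by rewrite -(outer _ mKB) => -[_ [V [oV KBV] <-] /ltW Vle]; exists V.
have cL : compact (K `\` V).
  by apply: compact_closedI => //; exact: open_closedC.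
exists (pi @` (K `\` V)); split.
- apply: continuous_compact => //; apply: continuous_subspaceT.
  exact: rcoset_continuous.
- move=> _ [x [Kx nVx] <-]; apply: contrapT => nA; apply: nVx; apply: KBV.
  by split => // -[].
- set D : set (borel G) := V `\` (K `\` B).
  have mD : measurable D by apply: measurableD => //; exact: open_borel.
  have muD : (mu D <= (e / (M + 1))%:E)%E.
    have Vfin : (mu V < +oo)%E.
      by apply: le_lt_trans Vlt _; rewrite lte_add_pinfty// ltry.
    rewrite /D measureD//; last exact: open_borel.
    rewrite setIidr// leeBlDl//; last by rewrite ge0_fin_numE.
  set C := pi @` (K `\` V).
  have mAC : measurable (A `\` C : set (borel X)).
    apply: measurableD => //; apply: closed_borel; apply: compact_closed => //.
    by apply: continuous_compact => //; apply: continuous_subspaceT; exact: rcoset_continuous.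
  have mW := mpreimage mAC.
  rewrite nuE//; apply: (@le_trans _ _
    (\int[mu]_(x in pi @^-1` (A `\` C)) (M%:E * (\1_D x)%:E))%E).
    apply: ge0_le_integral => //.
    - by move=> x _; rewrite lee_fin.
    - by apply: measurable_funTS; apply/measurable_EFinP; exact: continuous_borel.
    - by apply: measurable_funeM; apply: measurable_funTS; exact: measurable_indic_EFin.
    move=> x [/= Ax nCx]; rewrite -EFinM lee_fin.
    have [Kx|nKx] := pselect (K x); last by rewrite phiK// mulr_ge0// indicE.
    rewrite indicE mem_set ?mulr1; first exact: phiM.
    split=> [|[_]]; last by apply; split.
    by apply: contrapT => nVx; apply: nCx; exists x.
  rewrite ge0_integralZl//; last first.
    by apply: measurable_funTS; exact: measurable_indic_EFin.
  rewrite integral_indic//.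
  apply: (@le_trans _ _ (M%:E * (e / (M + 1))%:E)%E).
    apply: lee_wpmul2l; first by rewrite lee_fin.
    by apply: le_trans muD; apply: measure_mono => //; exact: measurableI.
  rewrite -EFinM lee_fin mulrCA -[leRHS]mulr1 ler_pM2l// ler_pdivrMr ?mul1r ?ltr_wpDl//.
  by rewrite lerDl.
Qed.

(** The decomposition f = |f| - (|f| - f) reduces to nonnegative functions. *)
Lemma Rintegral_density nu phi (f : X -> R) : Cc phi -> (forall x, 0 <= phi x) ->
  density nu phi -> continuous f ->
  \int[nu]_u f u = \int[mu]_x (f (pi x) * phi x).
Proof.
move=> Cphi phi0 nuE cf.
have nu_fin := density_finite Cphi nuE.
have pos (g : X -> R) : continuous g -> (forall u, 0 <= g u) ->
    \int[nu]_u g u = \int[mu]_x (g (pi x) * phi x).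
  move=> cg g0; congr fine.
  apply: (@ge0_integral_density _ _ (borel G) (borel X) R pi mpi mu phi
    (continuous_borel Cphi.1) phi0 nu nuE (EFin \o g)) => //.
  by apply/measurable_EFinP; exact: continuous_borel.
have [cabs cq] := continuous_norm_parts cf.
have iX (g : X -> R) : continuous g -> nu.-integrable setT (EFin \o g).
  by move=> cg; exact: (continuous_integrable hX cX nu_fin cg).
have iG (g : X -> R) : continuous g ->
    mu.-integrable setT (EFin \o (fun x => g (pi x) * phi x)).
  move=> cg; apply: (Cc_integrable hG mu_fin); apply: Cc_mull => // x.
  by apply: continuous_comp; [exact: rcoset_continuous|exact: cg].
transitivity (\int[nu]_u (`|f u| - (`|f u| - f u))).
  by apply: eq_Rintegral => u _; rewrite subKr.
rewrite (RintegralB measurableT (iX _ cabs) (iX _ cq)).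
rewrite (pos _ cabs)// (pos _ cq)//; last by move=> u; rewrite subr_ge0 ler_norm.
rewrite -(RintegralB measurableT (iG _ cabs) (iG _ cq)).
by apply: eq_Rintegral => x _; ring.
Qed.

Lemma exists_weil_measure : exists nu, weil_measure mu eta nu.
Proof.
have [phi [Cphi phi0 fphi]] := exists_cutoff hG lcG closedH haar_eta cX.
have [nu nuE] := exists_density Cphi.1 phi0.
exists nu; split; first exact: density_radon nuE.
- move=> g A mA.
  pose phig x := phi (x * g)%g.
  have Cphig : Cc phig by exact: Cc_mulgr.
  have phig0 x : 0 <= phig x by exact: phi0.
  have [nug nugE] := exists_density Cphig.1 phig0.
  (* phi and its translate phig are both cutoff functions, so they define the
     same measure on the cosets. *)
  have -> : nu A = nug A.
    apply: (radon_eq hX cX (density_radon Cphi phi0 nuE)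
      (density_radon Cphig phig0 nugE)) => // f cf f0.
    have cfpi : continuous (fun x => f (pi x)).
      by move=> x; apply: continuous_comp; [exact: rcoset_continuous|exact: cf].
    have finf (m : {measure set (borel X) -> \bar R}) psi : Cc psi -> density m psi ->
        (\int[m]_u (f u)%:E = (\int[m]_u f u)%:E)%E.
      move=> Cpsi mE; rewrite fineK//; apply: integrable_fin_num => //.
      exact: (continuous_integrable hX cX (density_finite Cpsi mE) cf).
    rewrite (finf _ _ Cphi nuE) (finf _ _ Cphig nugE); congr EFin.
    rewrite (Rintegral_density Cphi phi0 nuE cf) (Rintegral_density Cphig phig0 nugE cf).
    have fpiH (h : S) x : f (pi (val h * x)%g) = f (pi x).
      by rewrite rcoset_mull//; exact: subgroup_valP.
    have := fiber_swap1 hG lcG closedH haar_mu haar_eta left_eta cX Cphi Cphig cfpi fpiH.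
    under eq_Rintegral do rewrite fiber_mulr fphi mulr1 mulrC.
    by under [in RHS]eq_Rintegral do rewrite fphi mul1r.
  have AgE : [set coset_act u g | u in (A : set X)] =
      (fun u : X => coset_act u g^-1%g) @^-1` A.
    apply/seteqP; split=> [_ [u Au <-] /=|u /= Au]; first by rewrite coset_actK.
    by exists (coset_act u g^-1%g) => //; rewrite coset_actVK.
  have mAg : measurable ((fun u : X => coset_act u g^-1%g) @^-1` A : set (borel X)).
    rewrite -(setTI (_ @^-1` _)).
    exact: (continuous_measurable (@coset_act_continuous _ H g^-1%g)).
  rewrite AgE nuE// nugE// integral_mkcond [RHS]integral_mkcond.
  rewrite (@ge0_integral_image R G G mu mu (fun x => (x * g)%g)); last 4 first.
  - by apply: continuous_measurable; exact: continuous_mulr.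
  - exact: haar_preimage_mulr.
  - apply/(measurable_restrictT _ _).1; first exact: mpreimage.
    by apply: measurable_funTS; apply/measurable_EFinP; exact: continuous_borel Cphi.1.
  - by move=> x; rewrite patchE; case: ifP; rewrite ?lee_fin.
  apply: eq_integral => x _; rewrite !patchE.
  rewrite (_ : ((x * g)%g \in _) = (x \in pi @^-1` A))//.
  have E : coset_act (pi (x * g)%g) g^-1%g = pi x.
    by rewrite coset_act_rcoset mulgK.
  by apply/idP/idP => /set_mem h; apply/mem_set; move: h; rewrite /preimage/= E.
- move=> F [cF cK].
  have weil f : Cc f -> \int[mu]_x f x = \int[nu]_u fiber eta f (repr u).
    move=> Cf; rewrite (Rintegral_density Cphi phi0 nuE); last first.
      apply: continuous_on_cosets; first exact: fiber_continuous.
      by move=> x y xy; exact: fiber_coset.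
    have := fiber_swap1 hG lcG closedH haar_mu haar_eta left_eta cX Cphi Cf
      (c := fun=> 1) (@cst_continuous _ _ _) (fun _ _ => erefl).
    under eq_Rintegral do rewrite mulr1.
    under [in RHS]eq_Rintegral do rewrite fphi !mul1r.
    move=> <-; apply: eq_Rintegral => x _; rewrite mulrC.
    by congr (_ * _); apply: fiber_coset => //; rewrite rcoset_repr.
  have [cR cI] := (continuous_complexP F).1 cF.
  have F0 x : ~ closure [set x | F x != 0] x -> F x = 0.
    by move=> nx; apply/eqP; apply: contrapT => /negP Fx; apply: nx; exact: subset_closure.
  apply: complex_eqP => /=.
  + by apply: weil; split => //; exists (closure [set x | F x != 0]) => // x /F0 ->.
  + by apply: weil; split => //; exists (closure [set x | F x != 0]) => // x /F0 ->.
Qed.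

End weil_measure.

(** * Cocompact unimodular subgroups *)

Theorem corollary6p2 (R : realType) (G : topologicalGroupType) (H : subgroup G)
    (mu : {measure set (borel G) -> \bar R})
    (eta : {measure set (borel (subgroup_type H)) -> \bar R})
    (hausG : hausdorff_space G)
    (lcG : locally_compact [set: G])
    (closedH : closed (H : set G))
    (haar_mu : right_haar mu)
    (haar_eta : right_haar eta)
    (unimodularH : unimodular R (subgroup_type H))
    (cocompactH : compact [set: coset_space H]) :
  hecke_pair mu eta.
Proof.
have left_eta := unimodularH eta haar_eta.
split=> //; first exact: (exists_weil_measure hausG lcG).
move=> nu [radon_nu inv_nu _]; split; first exact: regular_representation_cocompact.
move=> x; exists (fun=> 1); first exact: hecke_algebra1.
exact: oner_neq0.
Qed.
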